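(* Let $\alpha\in(0,1]$, $\theta,\gamma>0$, and let $\mathcal{L}_t^{\alpha}$ be the operator $\mathcal{L}_t^{\alpha}u(t):=u(t)\,D_t^{\alpha}\log u(t)$, where $D_t^\alpha$ is the Caputo fractional derivative of order $\alpha$. Then the solution of the equation $$\mathcal{L}_t^{\alpha}\widehat u(\xi,t)=-\frac{\gamma}{2^{1-\alpha}}\,\xi\,\frac{\partial}{\partial\xi}\widehat u(\xi,t)-\frac{\theta}{2^{1-\alpha}}\,\xi^2\,\widehat u(\xi,t),\qquad \xi\in\mathbb{R},\ t\ge0,$$ with initial condition $\widehat u(\xi,0)=1$, is given by $$\widehat u(\xi,t)=\exp\left\{-\frac{\theta\xi^2}{2\gamma}\left[1-E_{\alpha,1}\!\left(-\gamma(2t)^{\alpha}\right)\right]\right\}.$$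
   Context: For $\alpha\in(0,1)$ and $v$ absolutely continuous on $[0,b]$ (for every $b>0$), the Caputo fractional derivative is $$D_t^{\alpha}v(t)=\frac{1}{\Gamma(1-\alpha)}\int_0^t\frac{v'(s)}{(t-s)^{\alpha}}\,ds ,$$ and $D_t^1 v=\frac{d}{dt}v$. The operator $\mathcal{L}_t^\alpha$ acts in the variable $t$ on positive functions $u$ for which $D_t^\alpha\log u$ is defined; for $\alpha=1$ it reduces to $\frac{d}{dt}$. In the equation, the operator acts on $t\mapsto\widehat u(\xi,t)$ for each fixed $\xi$. $E_{\beta,\delta}(x)=\sum_{j=0}^\infty \frac{x^j}{\Gamma(\beta j+\delta)}$ denotes the two-parameter Mittag-Leffler function.
   Formalization: For α<1 the Caputo derivative at t=0 is read as its limit t→0+ (with the literal integral, which is 0 there, the equation fails at t=0 for ξ≠0); ''the solution'' means unique among positive solutions jointly continuous on ℝ×[0,∞). *)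

(* Defs.v *)
From HB Require Import structures.
From mathcomp Require Import all_boot all_order all_algebra.
From mathcomp Require Import all_classical all_reals all_analysis.

Set Implicit Arguments.
Unset Strict Implicit.
Unset Printing Implicit Defensive.

Import Order.TTheory GRing.Theory Num.Theory.
Import numFieldNormedType.Exports.

Local Open Scope classical_set_scope.
Local Open Scope ring_scope.

(* Euler's integral; only meaningful for 0 < x. *)
Definition Gamma_fun (R : realType) (x : R) : R :=
  \int[lebesgue_measure]_(t in `]0, +oo[) (t `^ (x - 1) * expR (- t)).

Definition mittag_leffler (R : realType) (beta delta x : R) : R :=
  limn (series (fun j : nat => x ^+ j / Gamma_fun (beta * j%:R + delta))).

Definition abs_continuous (R : realType) (a b : R) (v : R -> R) : Prop :=
  forall e : R, 0 < e -> exists2 d : R, 0 < d &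
    forall (n : nat) (l r : 'I_n -> R),
      (forall i, a <= l i /\ l i <= r i /\ r i <= b) ->
      trivIset setT (fun i : 'I_n => `]l i, r i[%classic) ->
      \sum_(i < n) (r i - l i) < d ->
      \sum_(i < n) `|v (r i) - v (l i)| < e.

(* Functions of time live on [0, +oo[: the derivative below is the usual one at
   t > 0 and the right derivative at t = 0, so that the values of v at negative
   times are irrelevant. *)
Definition time_quotient (R : realType) (v : R -> R) (t s : R) : R :=
  (v s - v t) / (s - t).

Definition time_punctured_nbhs (R : realType) (t : R) : set_system R :=
  within `[0, +oo[%classic (t^').

Definition caputo_kernel (R : realType) (alpha : R) (v : R -> R) (t s : R) : R :=
  derive1 v s / (t - s) `^ alpha.

Definition caputo_integral (R : realType) (alpha : R) (v : R -> R) (t : R) : R :=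
  (Gamma_fun (1 - alpha))^-1 *
  \int[lebesgue_measure]_(s in `[0, t]) caputo_kernel alpha v t s.

(* For alpha < 1 the integral over [0, 0] is 0 whatever v is, so the derivative
   at t = 0 is read as the limit from the right. *)
Definition caputo (R : realType) (alpha : R) (v : R -> R) (t : R) : R :=
  if alpha == 1 then lim (time_quotient v t @ time_punctured_nbhs t)
  else if t == 0 then lim (caputo_integral alpha v s @[s --> 0^'+])
  else caputo_integral alpha v t.

(* The Caputo derivative of v exists at every t >= 0; in the case alpha < 1, a
   locally absolutely continuous v is differentiable only almost everywhere and
   the singular integral has to converge. *)
Definition caputo_derivable (R : realType) (alpha : R) (v : R -> R) : Prop :=
  if alpha == 1 then
    forall t : R, 0 <= t -> cvg (time_quotient v t @ time_punctured_nbhs t)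
  else
    [/\ forall b : R, 0 < b -> abs_continuous 0 b v,
        forall t : R, 0 < t ->
          lebesgue_measure.-integrable `[0, t]
            (EFin \o caputo_kernel alpha v t) &
        cvg (caputo_integral alpha v s @[s --> 0^'+])].

Definition Lop (R : realType) (alpha : R) (u : R -> R) (t : R) : R :=
  u t * caputo alpha (fun s => ln (u s)) t.

(* Classical positive solutions of the Cauchy problem: u is jointly continuous up
   to t = 0, and only its values at t >= 0 matter. *)
Definition is_solution (R : realType) (alpha theta gamma : R)
    (u : R -> R -> R) : Prop :=
  [/\ forall xi t : R, 0 <= t -> 0 < u xi t,
      {within [set p : R * R | 0 <= p.2], continuous (fun p => u p.1 p.2)},
      forall xi : R, caputo_derivable alpha (fun t => ln (u xi t)),
      forall xi t : R, 0 <= t ->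
        derivable (fun x => u x t) xi 1 /\
        Lop alpha (u xi) t =
          - (gamma / 2 `^ (1 - alpha)) * xi * derive1 (fun x => u x t) xi
          - theta / 2 `^ (1 - alpha) * xi ^+ 2 * u xi t &
      forall xi : R, u xi 0 = 1].

(* Main.v *)
(* Substituting v = ln u turns the equation into the linear one
   D_t^alpha v = - c xi dv/dxi - c' xi^2.

   Existence: the relaxation function Y t = E_{alpha,1}(- l t^alpha), with
   l = gamma 2^alpha, has Y' = - l t^(alpha-1) E_{alpha,alpha}(- l t^alpha), and
   integrating this series termwise against the Caputo kernel (Beta integrals)
   gives D^alpha Y = - l Y.

   Uniqueness: a maximum principle. If w - e t is maximal on [0, t] at its right
   endpoint t > 0, then the Caputo derivative of w is positive at t: for alpha < 1
   every tail integral of w' - e over ]r, t[ is nonnegative, and the increasing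
   weight (t - s)^(-alpha) is a positive combination of indicators of such tails.
   The tail integrals are increments of w because absolutely continuous functions
   are integrals of their derivatives. *)
Require Import Defs.
From HB Require Import structures.
From mathcomp Require Import all_boot all_order all_algebra.
From mathcomp Require Import all_classical all_reals all_analysis.
From mathcomp Require Import measurable_realfun ring lra.
Import Order.TTheory GRing.Theory Num.Theory.
Import numFieldNormedType.Exports.
Set Implicit Arguments.
Unset Strict Implicit.
Unset Printing Implicit Defensive.
Local Open Scope classical_set_scope.
Local Open Scope ring_scope.

(** * The fundamental theorem of calculus for absolutely continuous functions *)

Section nonoverlapping_intervals.
Context {R : realType}.
Implicit Types (a b : R) (f : R -> R) (s t : seq (R * R)).

(** On the ansatz ln u = xi^2 f(t) the linear equation becomes D^alpha f = - 2c f - c'. Here 2c =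
    gamma 2^alpha is the rate l, and f(0) = 0 forces f = (theta / (2 gamma)) (Y - 1). Uniqueness
    cannot rely on the ansatz, and competing solutions have no prescribed growth in xi. The main
    obstacle is their low regularity in time: for alpha < 1, ln u is only absolutely continuous, so
    its derivative may fail to exist at the very time where the maximum is attained. Only integrated
    information survives there, which is why tail integrals replace pointwise values and why the
    Lebesgue form of the fundamental theorem is needed. That theorem comes from the Jordan
    decomposition into monotone parts, a Radon-Nikodym density for the Stieltjes measure of each
    part, and Lebesgue differentiation, which identifies the density with the derivative almost
    everywhere. Subtracting e t is what makes the final inequality strict. *)

Definition apart (p q : R * R) := (p.2 <= q.1) || (q.2 <= p.1).

Definition itv_system a b s :=
  all (fun p => [&& a <= p.1, p.1 <= p.2 & p.2 <= b]) s && pairwise apart s.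

Definition total_length s := \sum_(p <- s) (p.2 - p.1).

Definition total_increment f s := \sum_(p <- s) `|f p.2 - f p.1|.

(* Absolute continuity over finite lists of nonoverlapping intervals, possibly
   degenerate: unlike indexed families, lists concatenate, which makes subdividing
   the intervals of a system easy. *)
Definition ac_on a b f := forall e, 0 < e -> exists2 d, 0 < d &
  forall s, itv_system a b s -> total_length s < d -> total_increment f s <= e.

Lemma abs_continuous_ac_on a b f : abs_continuous a b f -> ac_on a b f.
Proof.
move=> acf e e0; have [d d0 fd] := acf e e0; exists d => // s /andP[/allP sab sd] sl.
have nths (i : 'I_(size s)) : nth (0, 0) s i \in s by rewrite mem_nth.
apply/ltW; rewrite /total_increment (big_nth (0, 0)) big_mkord.
apply: (fd _ (fun i => (nth (0, 0) s i).1) (fun i => (nth (0, 0) s i).2)).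
- by move=> i; have /and3P[] := sab _ (nths i).
- move=> i j _ _ [x [/=]]; rewrite !in_itv/= => /andP[ix xi] /andP[jx xj].
  have ap k l : (k < l < size s)%N ->
      apart (nth (0, 0) s k) (nth (0, 0) s l).
    move=> /andP[kl ls]; apply: (pairwiseP (0, 0) sd) => //.
    by rewrite inE (ltn_trans kl).
  apply/val_inj; have [ij|ji|//] := ltngtP i j.
  + have /ap : (i < j < size s)%N by rewrite ij ltn_ord.
    rewrite /apart => /orP[h|h].
      by have := lt_le_trans xi (le_trans h (ltW jx)); rewrite ltxx.
    by have := lt_le_trans xj (le_trans h (ltW ix)); rewrite ltxx.
  + have /ap : (j < i < size s)%N by rewrite ji ltn_ord.
    rewrite /apart => /orP[h|h].
      by have := lt_le_trans xj (le_trans h (ltW ix)); rewrite ltxx.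
    by have := lt_le_trans xi (le_trans h (ltW jx)); rewrite ltxx.
- by move: sl; rewrite /total_length (big_nth (0, 0)) big_mkord.
Qed.

Lemma itv_partition_system l r (s : seq R) f : itv_partition l r s ->
  [/\ itv_system l r (zip (l :: s) s), total_length (zip (l :: s) s) = r - l
    & total_increment f (zip (l :: s) s) = variation l r f s].
Proof.
rewrite /variation /itv_system /total_length /total_increment.
elim: s l => [|x s IH] l [] /=.
  by move=> _ /eqP->; rewrite !big_nil subrr ?big_geq.
move=> /andP[lx xs] lst; have [/andP[IH1 IH2] IH3 IH4] := IH x (conj xs lst).
have xr : x <= r by case: (itv_partition_le (conj xs lst)).
split.
- rewrite /= lexx (ltW lx) xr/= IH2 andbT; apply/andP; split.
    apply/allP => p /(allP IH1)/and3P[h1 h2 h3].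
    by rewrite h2 h3 (le_trans (ltW lx)).
  by apply/allP => p /(allP IH1)/and3P[h1 h2 h3]; rewrite /apart /= h1.
- by rewrite big_cons /= IH3; lra.
- by rewrite big_cons /= IH4 big_nat_recl.
Qed.

Lemma itv_systemS a b p t u : itv_system a b (p :: t) ->
  itv_system p.1 p.2 u -> itv_system a b (t ++ u).
Proof.
rewrite /itv_system /= => /andP[/andP[/and3P[ap pp pb] tab] /andP[apt tt]].
move=> /andP[uab uu]; rewrite all_cat tab pairwise_cat tt uu andbT /=.
apply/andP; split.
  apply/allP => q /(allP uab)/and3P[h1 h2 h3].
  by rewrite h2 (le_trans ap h1) (le_trans h3 pb).
rewrite andbT; apply/allrelP => q w qt wu; have := allP apt q qt.
have /and3P[h1 h2 h3] := allP uab w wu; rewrite /apart => /orP[h|h].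
  by rewrite (le_trans h3 h) orbT.
by rewrite (le_trans h h1).
Qed.

Lemma total_lengthD s t : total_length (s ++ t) = total_length s + total_length t.
Proof. by rewrite /total_length big_cat. Qed.

Lemma total_incrementD f s t :
  total_increment f (s ++ t) = total_increment f s + total_increment f t.
Proof. by rewrite /total_increment big_cat. Qed.

(* The intervals of t are refined one after the other by partitions that nearly
   attain their total variations; s collects the refined intervals. *)
Lemma variation_system_le a b f (e d : R) s t :
  (forall s, itv_system a b s -> total_length s < d -> total_increment f s <= e) ->
  itv_system a b (t ++ s) -> total_length (t ++ s) < d ->
  ((total_increment f s)%:E + \sum_(p <- t) total_variation p.1 p.2 f <= e%:E)%E.
Proof.
move=> fd; elim: t s => [|p t IH] s; first by rewrite big_nil adde0 lee_fin; exact: fd.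
move=> sys len; have pp : p.1 <= p.2 by move: sys => /andP[/andP[/and3P[]]].
have ge0 : (0 <= \sum_(q <- t) total_variation q.1 q.2 f)%E.
  rewrite big_seq; apply: sume_ge0 => q qt; apply: total_variation_ge0.
  move: sys => /andP[/allP /(_ q)]; rewrite inE mem_cat qt orbT => h _.
  by case/and3P: (h isT).
have step u : itv_system p.1 p.2 u -> total_length u <= p.2 - p.1 ->
    ((total_increment f s + total_increment f u)%:E +
      \sum_(q <- t) total_variation q.1 q.2 f <= e%:E)%E.
  move=> su lu; rewrite -total_incrementD; apply: IH; rewrite catA.
    exact: itv_systemS sys su.
  apply: le_lt_trans len; rewrite !total_lengthD /= /total_length big_cons.
  by rewrite /total_length in lu; lra.
(* The empty refinement of [p] already bounds the remaining sum, hence its finiteness; the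
   inequality can then be solved for [total_variation p.1 p.2 f]. *)
have Yfin : (\sum_(q <- t) total_variation q.1 q.2 f)%E \is a fin_num.
  rewrite ge0_fin_numE//; have := step [::] isT.
  rewrite /total_length big_nil subr_ge0 => /(_ pp).
  by case: (\sum_(q <- t) _)%E => [r||] //; rewrite ?ltry// addey// leye_eq.
rewrite big_cons; move: Yfin step ge0.
case: (\sum_(q <- t) _)%E => // y _ step ge0.
suff : (total_variation p.1 p.2 f <= (e - total_increment f s - y)%:E)%E.
  case: (total_variation p.1 p.2 f) => [v||] //.
    by rewrite -!EFinD !lee_fin; lra.
  by rewrite addNye addeNy !leNye.
apply: ge_ereal_sup => _ /= [_ [w wp <-] <-].
have [su lu vu] := itv_partition_system f wp.
have := step _ su; rewrite lu vu => /(_ (lexx _)).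
by rewrite -EFinD !lee_fin; lra.
Qed.

End nonoverlapping_intervals.

(** * Jordan decomposition of absolutely continuous functions *)

Section jordan.
Context {R : realType}.
Implicit Types (a b : R) (f : R -> R).

(** The interval is cut into [N] pieces shorter than the [d] that belongs to e = 1; the total
    variation is at most 1 on each piece. *)
Lemma ac_on_total_variation_lty a b f : a <= b -> ac_on a b f ->
  (total_variation a b f < +oo)%E.
Proof.
move=> ab /(_ _ ltr01)[d d0 fd].
pose N := (Num.truncn ((b - a) / d)).+1; pose st := (b - a) / N%:R.
have N0 : 0 < N%:R :> R by rewrite ltr0n.
have st0 : 0 <= st by rewrite divr_ge0 ?subr_ge0// ltW.
have std : st < d.
  rewrite /st ltr_pdivrMr// mulrC -ltr_pdivrMr//.
  by rewrite -truncn_le_nat.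
have aN : a + N%:R * st = b by rewrite /st mulrC divfK ?subrKC// gt_eqF.
rewrite -aN; have : (N <= N)%N by [].
elim: {1 3}N => [|k IH] kN; first by rewrite mul0r addr0 total_variationxx.
have akb : a + k.+1%:R * st <= b by rewrite -aN lerD2l ler_wpM2r// ler_nat.
have ak : a <= a + k%:R * st by rewrite lerDl mulr_ge0.
have akk : a + k%:R * st <= a + k.+1%:R * st.
  by rewrite lerD2l ler_wpM2r// ler_nat.
rewrite (total_variationD f ak akk); apply: lte_add_pinfty; first exact/IH/ltnW.
have := @variation_system_le _ a b f 1 d [::] [:: (a + k%:R * st, a + k.+1%:R * st)] fd.
rewrite /itv_system /= ak akk akb => /(_ isT).
rewrite {1}/total_length !big_seq1 /total_increment big_nil add0e.
move=> h; apply: le_lt_trans (h _) _; last exact: ltry.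
by rewrite /= -natr1; move: std; lra.
Qed.

(** [P] is the variation function from [a], and N = P - f. Increments of [f] are dominated by those
    of [P], so increments of [N] lie between 0 and twice those of [P]; this is the origin of e / 2
    in the modulus of [N]. *)
Lemma ac_on_jordan a b f : a <= b -> ac_on a b f ->
  exists P N : R -> R, [/\
    {in `[a, b] &, nondecreasing_fun P}, {in `[a, b] &, nondecreasing_fun N},
    ac_on a b P, ac_on a b N & forall x, f x = P x - N x].
Proof.
move=> ab acf; pose P x := fine (total_variation a x f).
have TVP x y : a <= x -> x <= y -> y <= b ->
    total_variation x y f = (P y - P x)%:E.
  move=> ax xy yb; have := ac_on_total_variation_lty ab acf.
  have bp : a <= y by apply: le_trans xy.
  rewrite (total_variationD f bp yb) (total_variationD f ax xy) /P.
  rewrite (total_variationD f ax xy).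
  have := total_variation_ge0 f ax; have := total_variation_ge0 f xy.
  have := total_variation_ge0 f yb.
  case: (total_variation a x f) => [u||] //;
    case: (total_variation x y f) => [v||] //;
    case: (total_variation y b f) => [w||] // _ _ _;
    rewrite ?(addye, addey) ?ltxx//= => _.
  by congr (_%:E); lra.
have dfP x y : a <= x -> x <= y -> y <= b -> `|f y - f x| <= P y - P x.
  by move=> ax xy yb; rewrite -lee_fin -TVP//; exact: total_variation_ge.
have acP : ac_on a b P.
  move=> e e0; have [d d0 fd] := acf _ e0; exists d => // s sys sl.
  have := @variation_system_le _ a b f e d [::] s fd.
  rewrite cats0 => /(_ sys sl); rewrite /total_increment big_nil add0e -lee_fin.
  congr (_ <= _)%E; rewrite -sumEFin big_seq [RHS]big_seq; apply: eq_bigr => p ps.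
  move: sys => /andP[/allP /(_ _ ps)/and3P[h1 h2 h3] _].
  by rewrite TVP// ger0_norm// (le_trans _ (dfP _ _ h1 h2 h3)).
exists P, (fun x => P x - f x); split => //.
- move=> x y; rewrite !in_itv/= => /andP[ax _] /andP[_ yb] xy.
  by rewrite -subr_ge0 (le_trans _ (dfP _ _ ax xy yb)).
- move=> x y; rewrite !in_itv/= => /andP[ax _] /andP[_ yb] xy.
  by have := dfP _ _ ax xy yb; rewrite ler_norml => /andP[_]; lra.
- move=> e e0; have [d d0 Pd] := acP _ (divr_gt0 e0 (ltr0n _ 2 : 0 < 2)).
  exists d => // s sys sl; have := Pd _ sys sl.
  rewrite ler_pdivlMr// mulr_suml.
  apply: le_trans; rewrite /total_increment big_seq [leRHS]big_seq.
  apply: ler_sum => p ps.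
  move: sys => /andP[/allP /(_ _ ps)/and3P[h1 h2 h3] _].
  have h := dfP _ _ h1 h2 h3; have := le_trans (normr_ge0 _) h.
  move=> h0; rewrite (ger0_norm h0); move: h; rewrite !ler_norml => /andP[h4 h5].
  by apply/andP; split; lra.
- by move=> x; rewrite opprB subrKC.
Qed.

End jordan.

Lemma le_measure_subset d (T : measurableType d) (R : realType)
    (m : {measure set T -> \bar R}) (A B : set T) :
  measurable A -> measurable B -> A `<=` B -> (m A <= m B)%E.
Proof. by move=> mA mB AB; apply: le_measure; rewrite ?inE. Qed.

(** * Absolute continuity of Lebesgue-Stieltjes measures *)

Section stieltjes.
Context {R : realType}.
Implicit Types (a b : R) (U : set R).

Let mu : {measure set (measurableTypeR R) -> \bar R} := lebesgue_measure.

(** Components are indexed by the rationals they contain, so each nonempty one occurs many times. As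
    two components are equal or disjoint, [seqDU] leaves each either intact (first occurrence) or
    empty (repetition). *)
Lemma open_components U : open U -> exists F : nat -> set R,
  [/\ U = \bigcup_n F n, trivIset setT F, forall n, open (F n)
    & forall n, is_interval (F n)].
Proof.
move=> oU; pose B n := if unpickle n is Some q then bigcup_ointsub U q else set0.
have nB n m : B n `&` B m !=set0 -> B n = B m.
  rewrite /B; case: unpickle => [p|]; last by move=> [x []].
  case: unpickle => [q|]; last by move=> [x []].
  exact: nondisjoint_bigcup_ointsub.
have seqB n : seqDU B n = B n \/ seqDU B n = set0.
  have [[i /= ni BB]|h] := pselect (exists2 i, (i < n)%N & B i = B n).
    right; rewrite -subset0 => x [Bx] notB; apply: notB.
    by rewrite -bigcup_mkord; exists i => //; rewrite BB.
  left; apply/seteqP; split => [x []//|x Bx]; split => //; rewrite -bigcup_mkord => -[i /= ni Bi].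
  by apply: h; exists i => //; apply: nB; exists x.
exists (seqDU B); split.
- rewrite -seqDU_bigcup_eq; apply/seteqP; split => x.
    rewrite {1}(open_bigcup_rat oU) => -[q _ Uq].
    have Bq : B (pickle q) = bigcup_ointsub U q by rewrite /B pickleK.
    by apply: (@bigcup_sup _ _ (pickle q)); [exact: I|rewrite Bq].
  move=> [n _]; rewrite /B; case: unpickle => // q.
  exact: bigcup_ointsub_sub.
- exact: trivIset_seqDU.
- move=> n; case: (seqB n) => ->; last exact: open0.
  by rewrite /B; case: unpickle => [q|]; [exact: open_bigcup_ointsub|exact: open0].
- move=> n; case: (seqB n) => ->; last by move=> ? ? [].
  by rewrite /B; case: unpickle => [q|]; [exact: is_interval_bigcup_ointsub|move=> ? ? []].
Qed.

Lemma open_itv_bounds a b (I : set R) : open I -> is_interval I ->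
  I `<=` `]a, b[ -> I !=set0 ->
  exists l r, [/\ a <= l, l < r, r <= b & I = `]l, r[%classic].
Proof.
move=> oI iI Iab [x Ix].
have lbI : has_lbound I by exists a => y /Iab /=; rewrite in_itv/= => /andP[/ltW].
have ubI : has_ubound I by exists b => y /Iab /=; rewrite in_itv/= => /andP[_ /ltW].
have I0 : I !=set0 by exists x.
have IE : I = `]inf I, sup I[%classic.
  rewrite -[LHS]RhullK; last by rewrite inE.
  have nI1 : ~ I (inf I).
    move=> Iinf; have /nbhs_ballP[e /= e0 be] := oI _ Iinf.
    have /be/(ge_inf lbI) : ball (inf I) e (inf I - e / 2).
      by rewrite /ball /= opprB addrCA subrr addr0 gtr0_norm; lra.
    by lra.
  have nI2 : ~ I (sup I).
    move=> Isup; have /nbhs_ballP[e /= e0 be] := oI _ Isup.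
    have /be/(ub_le_sup ubI) : ball (sup I) e (sup I + e / 2).
      by rewrite /ball /= opprD addrA subrr sub0r normrN gtr0_norm; lra.
    by lra.
  by rewrite /Rhull (asboolT lbI) (asboolT ubI) (asboolF nI1) (asboolF nI2).
exists (inf I), (sup I); split => //.
- by apply: lb_le_inf => // y /Iab /=; rewrite in_itv/= => /andP[/ltW].
- by move: Ix; rewrite {1}IE /= in_itv/= => /andP[]; exact: lt_trans.
- by apply: ge_sup => // y /Iab /=; rewrite in_itv/= => /andP[_ /ltW].
Qed.

Lemma lebesgue_stieltjes_itvoc (g : cumulative R R) a b : a <= b ->
  lebesgue_stieltjes_measure g `]a, b] = (g b - g a)%:E.
Proof.
move=> ab; rewrite /lebesgue_stieltjes_measure /measure_extension/=.
rewrite measurable_mu_extE/=; last exact: is_ocitv.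
by rewrite wlength_itv_bnd.
Qed.

(** Finitely many components of [U] form a system of total length at most [mu U], to which the bound
    on increments applies; countable additivity extends it to [U]. Each component is enlarged by its
    right endpoint, since the Stieltjes measure of a half-open interval is the increment of [g]. *)
Lemma lebesgue_stieltjes_open_le (g : cumulative R R) a b (d e : R) U :
  (forall s, itv_system a b s -> total_length s < d -> total_increment g s <= e) ->
  open U -> U `<=` `]a, b[ -> (mu U < d%:E)%E ->
  (lebesgue_stieltjes_measure g U <= e%:E)%E.
Proof.
move=> gd oU Uab Ud; have [F [UF tF oF iF]] := open_components oU.
have mF n : measurable (F n : set (measurableTypeR R)) by apply: open_measurable; exact: oF.
have FU n : F n `<=` U by rewrite UF; exact: (@bigcup_sup _ _ n).
(* The last clause drives the induction: an overlap of the new component with a listed interval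
   would give a point common to two components of different index. Empty components are dropped. *)
have finite n : exists s : seq (R * R), [/\ itv_system a b s,
    (total_length s)%:E = (\sum_(0 <= i < n) mu (F i))%E,
    (\sum_(0 <= i < n) lebesgue_stieltjes_measure g (F i) <=
      (total_increment g s)%:E)%E &
    forall p, p \in s -> p.1 < p.2 /\ exists2 i, (i < n)%N & `]p.1, p.2[ `<=` F i].
  elim: n => [|n [s [sys sl si sF]]].
    by exists [::]; split => //; rewrite /total_length /total_increment ?big_nil.
  have [Fn0|Fn0] := pselect (F n !=set0); last first.
    have {}Fn0 : F n = set0 by apply: contrapT => /eqP/set0P.
    exists s; rewrite !big_nat_recr//= Fn0 !measure0 !adde0; split => // p /sF[? [i h1 h2]].
    by split => //; exists i => //; exact: ltnW.
  have [l [r [al lr rb Fn]]] := open_itv_bounds (oF n) (iF n) (subset_trans (FU n) Uab) Fn0.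
  exists ((l, r) :: s); split.
  - move: sys => /andP[h1 h2]; rewrite /itv_system /= h1 h2 al (ltW lr) rb /= andbT.
    apply/allP => p ps; have [pp [i ni pF]] := sF _ ps; rewrite /apart /=.
    rewrite leNgt -implybE; apply/implyP => pr; rewrite leNgt; apply/negP => lp.
    have x1 : Num.max l p.1 < Num.min r p.2 by rewrite gt_max !lt_min lr lp pr.
    pose x := (Num.max l p.1 + Num.min r p.2) / 2.
    have [x2 x3] : Num.max l p.1 < x /\ x < Num.min r p.2 by rewrite /x; split; lra.
    have : (F i `&` F n) x.
      move: x2 x3; rewrite gt_max lt_min => /andP[? ?] /andP[? ?]; split.
        by apply: pF; rewrite /= in_itv/=; apply/andP.
      by rewrite Fn /= in_itv/=; apply/andP.
    move=> Fx; have := tF i n I I (ex_intro _ x Fx) => ein.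
    by move: ni; rewrite ein ltnn.
  - rewrite big_nat_recr//= -sl /total_length big_cons /= Fn /mu lebesgue_measure_itv/= lte_fin lr.
    by rewrite -EFinB -EFinD addrC.
  - rewrite big_nat_recr//= addeC /total_increment big_cons EFinD; apply: leeD => //.
    rewrite (@le_trans _ _ (lebesgue_stieltjes_measure g `]l, r]%classic))//.
      apply: le_measure_subset; [exact: mF|by []|].
      by rewrite Fn; apply: subset_itvl; rewrite bnd_simp.
    by rewrite (lebesgue_stieltjes_itvoc g (ltW lr)) lee_fin ler_norm.
  - move=> p; rewrite inE => /predU1P[->/=|/sF[? [i h1 h2]]].
      by split => //; exists n => //; rewrite Fn.
    by split => //; exists i => //; exact: ltnW.
rewrite UF measure_bigcup//=; apply: lime_le.
  exact: is_cvg_nneseries.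
apply: nearW => n; have [s [sys sl si _]] := finite n.
under eq_bigl do rewrite in_setT.
apply: le_trans si _; rewrite lee_fin; apply: gd => //.
rewrite -lte_fin sl; apply: le_lt_trans Ud.
rewrite UF measure_bigcup//=.
under [leRHS]eq_eseriesl do rewrite in_setT.
exact: nneseries_lim_ge.
Qed.

Let clamp a b (x : R) := Num.min b (Num.max a x).

Let clamp_le a b x y : x <= y -> clamp a b x <= clamp a b y.
Proof.
by move=> xy; rewrite /clamp !(le_min, ge_min, ge_max, le_max) !lexx xy /= !orbT.
Qed.

Let clamp_in a b x : a <= b -> a <= clamp a b x <= b.
Proof. by move=> ab; rewrite /clamp le_min ge_min le_max !lexx ab. Qed.

(** Clamping is monotone and never lengthens an interval, so it maps systems to systems in [a, b];
    some intervals become degenerate, which systems allow. *)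
Lemma clamp_ac_on a b c d (G : R -> R) : a <= b -> ac_on a b G ->
  ac_on c d (fun x => G (clamp a b x)).
Proof.
move=> ab acG e e0; have [dl dl0 Gd] := acG e e0; exists dl => // s /andP[scd sap] sl.
pose cl (p : R * R) := (clamp a b p.1, clamp a b p.2).
have -> : total_increment (fun x => G (clamp a b x)) s = total_increment G (map cl s).
  by rewrite /total_increment big_map.
apply: Gd.
  apply/andP; split.
    rewrite all_map; apply/allP => p /(allP scd)/and3P[_ pp _] /=.
    have /andP[-> _] := clamp_in p.1 ab; have /andP[_ ->] := clamp_in p.2 ab.
    by rewrite clamp_le.
  rewrite pairwise_map; apply: sub_pairwise sap => p q /orP[h|h]; apply/orP.
    by left; exact: clamp_le.
  by right; exact: clamp_le.
apply: le_lt_trans sl; rewrite /total_length big_map big_seq [leRHS]big_seq.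
apply: ler_sum => p /(allP scd)/and3P[_ pp _] /=.
rewrite /clamp.
case: (leP a p.1) => ?; case: (leP a p.2) => ?; do ?case: (leP b) => ?; lra.
Qed.

Lemma ac_on_right_continuous (g : R -> R) :
  (forall c d, ac_on c d g) -> right_continuous g.
Proof.
move=> acg x; apply/cvgrPdist_le => /= e e0.
have [d d0 gd] := acg x (x + 1) e e0.
near=> y.
have xy : x < y by near: y; exact: nbhs_right_gt.
have yd : y < x + d by near: y; apply: nbhs_right_lt; rewrite ltrDl.
have y1 : y < x + 1 by near: y; apply: nbhs_right_lt; rewrite ltrDl.
have := gd [:: (x, y)]; rewrite /itv_system /total_length /total_increment !big_seq1 /=.
by rewrite lexx (ltW xy) (ltW y1) distrC => -> //; lra.
Unshelve. all: by end_near. Qed.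

(* G, extended by constants, is the distribution function of a Lebesgue-Stieltjes
   measure; covering a null set by an open set of small length shows that this
   measure is absolutely continuous, hence has a Radon-Nikodym density. *)
Lemma nondecreasing_ac_on_density a b (G : R -> R) : a < b ->
  {in `[a, b] &, nondecreasing_fun G} -> ac_on a b G ->
  exists h : R -> R, mu.-integrable setT (EFin \o h) /\
    forall x, a <= x <= b -> (\int[mu]_(t in `]a, x]) (h t)%:E)%E = (G x - G a)%:E.
Proof.
move=> ab ndG acG; pose g0 x := G (clamp a b x).
have clab x := clamp_in x (ltW ab).
have acg c d : ac_on c d g0 by exact/clamp_ac_on/acG/ltW.
have ndg : nondecreasing g0.
  by move=> x y xy; apply: ndG; rewrite ?in_itv/= ?clab//; exact: clamp_le.
have rcg : right_continuous g0 by exact: ac_on_right_continuous.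
pose g : cumulative R R := HB.pack g0 (isCumulative.Build R _ R g0 ndg rcg).
have gab c d : c <= d ->
    lebesgue_stieltjes_measure g `]c, d] = (g0 d - g0 c)%:E.
  exact: lebesgue_stieltjes_itvoc.
have mab : measurable (`]a, b]%classic : set (measurableTypeR R)) by [].
have fab : (lebesgue_stieltjes_measure g `]a, b]%classic < +oo)%E.
  by rewrite gab ?ltry// ltW.
pose nu := mfrestr mab fab.
have dom : nu `<< mu.
  apply/null_content_dominatesP => A mA A0.
  have nuA : nu A = lebesgue_stieltjes_measure g (A `&` `]a, b]) by [].
  apply/eqP; rewrite eq_le measure_ge0 andbT; apply/lee_addgt0Pr => e e0.
  rewrite add0e.
  (* An open set covering a part of ]a, b] may have to reach beyond [b]; the constant extension [g0]
     is absolutely continuous on the larger interval too. *)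
  have [d d0 gd] := acg (a - 1) (b + 1) e e0.
  have mAab : measurable (A `&` `]a, b] : set (measurableTypeR R)) by exact: measurableI.
  have muA : mu (A `&` `]a, b]%classic) = 0%E.
    by apply/eqP; rewrite eq_le measure_ge0 andbT -A0 le_measure_subset.
  have [|U [oU AU Ud]] := @lebesgue_regularity_outer R _ _ mAab _ d0.
    by rewrite muA ltry.
  have mU : measurable (U : set (measurableTypeR R)).
    exact: open_measurable.
  pose V := U `&` `]a - 1, b + 1[%classic.
  have oV : open V by apply: openI => //; exact: interval_open.
  have mV : measurable (V : set (measurableTypeR R)).
    exact: open_measurable.
  rewrite nuA; apply: (@le_trans _ _ (lebesgue_stieltjes_measure g V));
    last apply: (@lebesgue_stieltjes_open_le g (a - 1) (b + 1) d e V gd oV).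
  - apply: le_measure_subset => // x [Ax]; rewrite /= in_itv/= => /andP[ax xb].
    split; first by apply: AU; split => //=; rewrite in_itv/= ax.
    by rewrite /= in_itv/=; apply/andP; split; lra.
  - by move=> x [].
  - apply: le_lt_trans Ud; rewrite (measureDI mu mV mAab).
    rewrite -[leRHS]adde0; apply: leeD.
      apply: le_measure_subset; [exact: measurableD|exact: measurableD|].
      by move=> x [[Ux _] nA]; split.
    by rewrite -muA; apply: le_measure_subset; [exact: measurableI|by []|move=> x []].
have [h [h0 hfin hi hnu]] := radon_nikodym_sigma_finite dom.
exists (fine \o h); have hE : EFin \o (fine \o h) = h by apply/funext => x /=; rewrite fineK.
rewrite hE; split => // x /andP[ax xb].
transitivity (\int[mu]_(t in `]a, x]) h t)%E; first by rewrite -[in RHS]hE.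
rewrite -hnu; last by [].
have clid y : a <= y -> y <= b -> clamp a b y = y.
  by move=> ay yb; rewrite /clamp max_r// min_r.
rewrite /= /mfrestr /mrestr setIidl; last by apply: subset_itvl; rewrite bnd_simp.
by rewrite gab// /g0 !clid// ltW.
Qed.

End stieltjes.

(** * The derivative as density *)

Section lebesgue_ftc.
Context {R : realType}.
Implicit Types (a b : R) (f : R -> R).

Let mu : {measure set (measurableTypeR R) -> \bar R} := lebesgue_measure.

Lemma ac_on_density a b f : a < b -> ac_on a b f ->
  exists h : R -> R, mu.-integrable setT (EFin \o h) /\
    forall x, a <= x <= b -> \int[mu]_(t in `]a, x]) h t = f x - f a.
Proof.
move=> ab /(ac_on_jordan (ltW ab))[P [N [ndP ndN acP acN fE]]].
have [p [ip Pp]] := nondecreasing_ac_on_density ab ndP acP.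
have [n [iN Nn]] := nondecreasing_ac_on_density ab ndN acN.
exists (fun t => p t - n t); split; first exact: eq_integrable (integrableB measurableT ip iN).
move=> x axb; rewrite RintegralB//; last 2 first.
- exact: integrableS ip.
- exact: integrableS iN.
by rewrite /Rintegral Pp// Nn// !fE /=; lra.
Qed.

(** [f] is [f a] plus the integral of a density [h], and Lebesgue differentiation gives derive1 f =
    h almost everywhere. Measurability of [derive1 f] is a hypothesis because almost everywhere
    equality alone does not transmit it. *)
Lemma abs_continuous_ftc a b f : a < b -> abs_continuous a b f ->
  measurable_fun `]a, b[ (derive1 f) ->
  mu.-integrable `]a, b[ (EFin \o derive1 f) /\
  forall x, a <= x <= b -> \int[mu]_(t in `]a, x[) derive1 f t = f x - f a.
Proof.
move=> ab /abs_continuous_ac_on acf mf'; have [h [ih fh]] := ac_on_density ab acf.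
have ihS (D : set (measurableTypeR R)) : measurable D -> mu.-integrable D (EFin \o h).
  by move=> mD; exact: integrableS ih.
have aeh : {ae mu, forall t, t \in `]a, b[ -> derive1 f t = h t}.
  have ihy (y : R) : mu.-integrable `]a, y] (EFin \o h) by exact: ihS.
  have locf := open_integrable_locally openT ih.
  have /= := @FTC1 R h (BRight a) ihy locf.
  apply: (@filterS _ _ (ae_filter_ringOfSetsType mu)) => t ht.
  rewrite in_itv/= => /andP[at_ tb].
  pose F y := \int[mu]_(s in `]a, y]) h s.
  have [dF <-] : derivable F t 1 /\ derive1 F t = h t.
    by apply: ht; rewrite lte_fin.
  have nF : \forall y \near t, f y = (F + cst (f a)) y.
    have : t \in `]a, b[ by rewrite in_itv/= at_.
    move/near_in_itvoo; apply: filterS => y; rewrite in_itv/= => /andP[ay yb].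
    have -> : (F + cst (f a)) y = F y + f a by [].
    by rewrite /F fh ?subrK// !ltW.
  rewrite !derive1E (near_eq_derive _ nF) (deriveD dF (derivable_cst _ _ _)).
  by rewrite derive_cst addr0.
have aeh' x : x <= b -> ae_eq mu `]a, x[%classic (EFin \o derive1 f) (EFin \o h).
  move=> xb; apply: (@filterS _ _ (ae_filter_ringOfSetsType mu) _ _ _ aeh) => t ht /= /[!in_itv]/= /andP[at_ tx].
  by congr EFin; apply: ht; rewrite in_itv/= at_ (lt_le_trans tx).
have mh x : measurable_fun `]a, x[ h.
  by have /integrableP[/measurable_EFinP] : mu.-integrable `]a, x[ (EFin \o h) by exact: ihS.
split.
  have /integrableP[_ hoo] : mu.-integrable `]a, b[ (EFin \o h) by exact: ihS.
  apply/integrableP; split; first exact/measurable_EFinP.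
  apply: le_lt_trans hoo; rewrite le_eqVlt; apply/orP; left; apply/eqP.
  apply: ge0_ae_eq_integral => //=.
  - by apply/measurable_EFinP; exact: measurableT_comp mf'.
  - by apply/measurable_EFinP; exact: measurableT_comp (mh b).
  - apply: (@filterS _ _ (ae_filter_ringOfSetsType mu) _ _ _ (aeh' b (lexx _))).
    by move=> t ht /ht [->].
move=> x /andP[ax xb]; rewrite -fh ?ax//.
rewrite -Rintegral_itv_bndo_bndc; last exact: ihS.
congr fine; apply: ae_eq_integral; [by []| | |exact: aeh'].
  apply/measurable_EFinP; apply: measurable_funS mf' => //.
  by apply: subset_itvl; rewrite bnd_simp.
by apply/measurable_EFinP; exact: mh.
Qed.

End lebesgue_ftc.

(** * The Gamma and Beta integrals *)

Section affine_change_of_variables.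
Context {R : realType}.
Let mu : {measure set (measurableTypeR R) -> \bar R} := lebesgue_measure.

(** Lebesgue measure and [c] times its image under x -> c x + d agree on half-open intervals, hence
    on all measurable sets. *)
Lemma ge0_integral_affine (c d : R) (f : R -> \bar R) : 0 < c ->
  measurable_fun setT f -> (forall x, (0 <= f x)%E) ->
  (\int[mu]_x f x = c%:E * \int[mu]_x f (c * (x : R) + d)%R)%E.
Proof.
move=> c0 mf f0; pose phi (x : measurableTypeR R) : measurableTypeR R := c * x + d.
have mphi : measurable_fun setT phi.
  by apply: measurable_funD => //; apply: measurable_funM.
pose pf : {measure set (measurableTypeR R) -> \bar R} := pushforward mu phi.
pose nu := mscale (NngNum (ltW c0)) (pf mphi).
have nuE A : measurable A -> mu A = nu A.
  move=> mA; apply: (@lebesgue_measure_unique R nu _ A mA) => X /ocitvP[->|[[a b] /= ab ->]].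
    by rewrite !measure0.
  rewrite /nu /mscale /= /pf /= /pushforward.
  have -> : phi @^-1` `]a, b]%classic = `](a - d) / c, (b - d) / c]%classic.
    apply/seteqP; split => x; rewrite /= !in_itv/= /phi => /andP[h1 h2].
      by rewrite ltr_pdivrMr// ler_pdivlMr// mulrC; apply/andP; split; lra.
    by move: h1 h2; rewrite ltr_pdivrMr// ler_pdivlMr// mulrC => h1 h2; apply/andP; split; lra.
  rewrite !lebesgue_measure_itv/= !lte_fin ab ltr_pM2r ?invr_gt0// ltrD2r ab.
  rewrite -!EFinB -EFinM -mulrBl mulrC divfK ?gt_eqF//.
  by congr EFin; lra.
rewrite (@eq_measure_integral _ _ _ _ nu); last by move=> A mA _; exact: nuE.
rewrite ge0_integral_mscale//= ge0_integral_pushforward//=.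
Qed.

Lemma integral_expRN : (\int[mu]_(x in `[0%R, +oo[) (expR (- x))%:E = 1)%E.
Proof.
have dF (x : R) : is_derive x 1 (fun x => - expR (- x)) (expR (- x)).
  have h : is_derive x 1 (- (expR \o -%R)) (- (expR (- x) * (- 1))).
    exact: is_deriveN.
  by move: h; rewrite mulrN1 opprK.
have cF (x : R) : continuous_at x (fun x => expR (- x)).
  by apply: continuous_comp; [exact: opp_continuous|exact: continuous_expR].
rewrite (@ge0_continuous_FTC2y _ _ (fun x => - expR (- x)) _ 0).
- by rewrite oppr0 expR0 sub0e -EFinN opprK.
- by move=> x _; exact: expR_ge0.
- exact: continuous_subspaceT.
- by rewrite -oppr0; apply: cvgN; exact: cvgr_expR.
- by move=> x _; have [] := dF x.
- by apply: cvg_at_right_filter; apply: cvgN; exact: cF.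
- by move=> x _; rewrite derive1E; have [_ ->] := dF x.
Qed.

(** The integrand is unbounded at 0 when p < 1, so the antiderivative is used on [1/(n+1), 1] and
    monotone convergence does the rest. *)
Lemma integral_powR_lt1 (p : R) : 0 < p ->
  (\int[mu]_(x in `]0%R, 1%R]) (x `^ (p - 1))%:E <= (p^-1)%:E)%E.
Proof.
move=> p0; pose F n : set (measurableTypeR R) := `[n.+1%:R^-1, 1]%classic.
have Fbig : \bigcup_n F n = `]0, 1]%classic.
  apply/seteqP; split => x.
    move=> [n _]; rewrite /F /= !in_itv/= => /andP[h ->]; rewrite andbT.
    by apply: lt_le_trans h; rewrite invr_gt0.
  rewrite /= in_itv/= => /andP[x0 x1].
  exists (Num.truncn x^-1) => //; rewrite /F /= in_itv/= x1 andbT.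
  rewrite invf_ple ?posrE//.
  by rewrite ltW// -truncn_le_nat.
rewrite -Fbig.
have mf : measurable_fun setT (fun x : measurableTypeR R => (x `^ (p - 1))%:E).
  by apply/measurable_EFinP; exact: measurable_powR.
have cv : (\int[mu]_(x in F n) (x `^ (p - 1))%:E)%E @[n --> \oo] -->
    (\int[mu]_(x in \bigcup_n F n) (x `^ (p - 1))%:E)%E.
  apply: ge0_nondecreasing_set_cvg_integral.
  - move=> m n mn; apply/subsetPset => x; rewrite /F /= !in_itv/= => /andP[h ->].
    by rewrite andbT (le_trans _ h)// lef_pV2 ?posrE// ler_nat.
  - by move=> n; exact: measurable_itv.
  - by move=> n; exact: measurable_funTS.
  - by move=> n x _; rewrite lee_fin powR_ge0.
rewrite -(cvg_lim _ cv)//; apply: lime_le; first by apply/cvg_ex; eexists; exact: cv.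
apply: nearW => -[|n].
  by rewrite /F invr1 set_itv1 integral_set1 lee_fin invr_ge0 ltW.
have n0 : 0 < (n.+2%:R^-1 : R) by rewrite invr_gt0.
have dF (x : R) : 0 < x -> is_derive x 1 (fun x => p^-1 * x `^ p) (x `^ (p - 1)).
  move=> x0; have h : is_derive x 1 (p^-1 \*: (fun y : R => y `^ p : R^o))
      (p^-1 *: (p * x `^ (p - 1))).
    by apply: is_deriveZ; exact: is_derive1_powR.
  by move: h; rewrite [_ *: _]mulrA mulVf ?mul1r// gt_eqF.
pose G (x : R) := p^-1 * x `^ p.
have cF (x : R) : 0 < x -> {for x, continuous G}.
  by move=> x0; apply/differentiable_continuous/derivable1_diffP; have [] := dF x x0.
rewrite /F (@continuous_FTC2 _ _ G).
- rewrite -EFinB lee_fin /G powR1 mulr1 lerBlDr lerDl mulr_ge0 ?powR_ge0//.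
  by rewrite invr_ge0 ltW.
- by rewrite invf_lt1// ltr1n.
- apply: derivable_within_continuous => x /[!in_itv]/= /andP[nx _].
  by apply: derivable_powR; rewrite in_itv/= (lt_le_trans n0).
- split.
  + by move=> x /[!in_itv]/= /andP[nx _]; have [] := dF x (lt_trans n0 nx).
  + by apply: cvg_at_right_filter; exact: cF.
  + by apply: cvg_at_left_filter; exact: cF.
- move=> x /[!in_itv]/= /andP[nx _]; rewrite derive1E.
  by have [_ ->] := dF x (lt_trans n0 nx).
Qed.

End affine_change_of_variables.

Section gamma_beta.
Context {R : realType}.
Implicit Types (p q t x : R).
Let mu : {sigma_finite_measure set (measurableTypeR R) -> \bar R} := lebesgue_measure.
Notation RM := (measurableTypeR R).

(** Extension by 0 puts the Gamma and Beta integrals on the whole line, where affine substitutions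
    and Tonelli involve no change of domain. *)
Definition pos_powR p (s : R) : R := s `^ (p - 1) * \1_(`]0, +oo[%classic : set R) s.

Lemma pos_powR_ge0 p s : 0 <= pos_powR p s.
Proof. by rewrite mulr_ge0 ?powR_ge0// indicE. Qed.

Lemma pos_powR_gt0E p s : 0 < s -> pos_powR p s = s `^ (p - 1).
Proof. by move=> s0; rewrite /pos_powR indicE mem_set ?mulr1//= in_itv/= s0. Qed.

Lemma pos_powR_le0E p s : s <= 0 -> pos_powR p s = 0.
Proof.
move=> s0; rewrite /pos_powR indicE memNset ?mulr0//= in_itv/= andbT.
by apply/negP; rewrite -leNgt.
Qed.

Lemma measurable_pos_powR p : measurable_fun setT (pos_powR p : RM -> RM).
Proof.
apply: measurable_funM; first exact: measurable_powR.
by apply: measurable_indic; exact: measurable_itv.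
Qed.

Lemma integral_pos_powRE p (f : R -> R) :
  (\int[mu]_(t in `]0%R, +oo[) (t `^ (p - 1) * f t)%:E =
   \int[mu]_t (pos_powR p t * f t)%:E)%E.
Proof.
rewrite integral_mkcond; apply: eq_integral => t _; rewrite patchE.
have [t0|t0] := ltP 0 t; first by rewrite mem_set ?pos_powR_gt0E//= in_itv/= t0.
rewrite memNset ?pos_powR_le0E ?mul0r//= in_itv/= andbT.
by apply/negP; rewrite -leNgt.
Qed.

(* Euler's integral in the extended reals, so that Tonelli applies before its
   finiteness is known. *)
Definition egamma p : \bar R := (\int[mu]_t (pos_powR p t * expR (- t))%:E)%E.

Lemma measurable_expRN : measurable_fun setT (fun t : RM => expR (- t) : RM).
Proof. by apply: measurableT_comp => //; exact: measurable_expR. Qed.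

Lemma measurable_egamma p :
  measurable_fun setT (fun t : RM => (pos_powR p t * expR (- t))%:E).
Proof.
apply/measurable_EFinP; apply: measurable_funM; first exact: measurable_pos_powR.
exact: measurable_expRN.
Qed.

Lemma egamma1 : egamma 1 = 1%E.
Proof.
rewrite /egamma -integral_pos_powRE -[RHS]integral_expRN.
rewrite -(integral_itv_obnd_cbnd (r := 0)).
  by apply: eq_integral => t _; rewrite subrr powRr0 mul1r.
by apply/measurable_EFinP/measurable_funTS; exact: measurable_expRN.
Qed.

Lemma egamma_lty p : 0 < p -> (egamma p < +oo)%E.
Proof.
(* For t > 1 the power is at most t^(n+1), and (t/2)^(n+1) <= (n+1)! exp(t/2), so half of the
   exponential absorbs it at the cost of [C]. The summand [+ 0] in [g] matches the form of the
   affine substitution. *)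
move=> p0; pose n := Num.truncn p; pose C := 2 ^+ n.+1 * n.+1`!%:R : R.
have C0 : 0 <= C by rewrite mulr_ge0// exprn_ge0.
pose g t := pos_powR p t * \1_(`]0, 1]%classic : set R) t +
  C * (pos_powR 1 t * expR (- (2^-1 * t + 0))).
have leg t : pos_powR p t * expR (- t) <= g t.
  rewrite /g; have [t0|t0] := leP t 0.
    by rewrite !pos_powR_le0E// !mul0r mulr0 addr0.
  rewrite !pos_powR_gt0E// subrr powRr0 mul1r addr0.
  have [t1|t1] := leP t 1.
    rewrite indicE mem_set/= ?in_itv/= ?t0// mulr1.
    rewrite -[leLHS]addr0; apply: lerD; last by rewrite mulr_ge0// expR_ge0.
    by rewrite ler_piMr ?powR_ge0// -expR0 ler_expR oppr_le0 ltW.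
  rewrite indicE memNset ?mulr0 ?add0r/=; last by rewrite in_itv/= t0/= leNgt t1.
  have -> : expR (- t) = expR (- (2^-1 * t)) * expR (- (2^-1 * t)).
    by rewrite -expRD; congr expR; lra.
  rewrite mulrA ler_wpM2r ?expR_ge0// expRN ler_pdivrMr ?expR_gt0//.
  have h1 : t `^ (p - 1) <= t ^+ n.+1.
    rewrite -(powR_mulrn _ (ltW t0)); apply: ler_powR; first exact: ltW.
    have : p < n.+1%:R by rewrite -truncn_le_nat.
    by lra.
  apply: le_trans h1 _; have t20 : 0 <= 2^-1 * t by rewrite mulr_ge0// ltW.
  have := expR_ge1Dxn n t20; rewrite exprMn exprVn => h2.
  rewrite /C -ler_pdivrMl ?mulr_gt0 ?exprn_gt0//.
  rewrite invfM; lra.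
have mg1 : measurable_fun setT (fun t : RM => pos_powR p t * \1_(`]0, 1]%classic : set R) t).
  by apply: measurable_funM; [exact: measurable_pos_powR|apply: measurable_indic; exact: measurable_itv].
have mg2 : measurable_fun setT (fun t : RM => pos_powR 1 t * expR (- (2^-1 * t + 0)) : RM).
  apply: measurable_funM; first exact: measurable_pos_powR.
  by apply: (measurableT_comp measurable_expRN); apply: measurable_funD => //; exact: measurable_funM.
apply: (@le_lt_trans _ _ (\int[mu]_t (g t)%:E)%E).
  apply: ge0_le_integral => //=.
  - by move=> t _; rewrite lee_fin mulr_ge0 ?expR_ge0// pos_powR_ge0.
  - exact: measurable_egamma.
  - apply/measurable_EFinP; apply: measurable_funD => //.
    exact: measurable_funM.
  - by move=> t _; rewrite lee_fin.
rewrite /g; under eq_integral do rewrite EFinD EFinM.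
rewrite ge0_integralD//=; last 4 first.
- by move=> t _; rewrite lee_fin mulr_ge0// ?pos_powR_ge0// indicE.
- exact/measurable_EFinP.
- by move=> t _; rewrite lee_fin mulr_ge0// mulr_ge0 ?expR_ge0 ?pos_powR_ge0.
- by apply/measurable_EFinP; exact: measurable_funM.
apply: lte_add_pinfty.
  apply: (@le_lt_trans _ _ (p^-1)%:E); last exact: ltry.
  apply: le_trans (integral_powR_lt1 p0).
  rewrite [leRHS]integral_mkcond; apply: ge0_le_integral => //=.
  - by move=> t _; rewrite lee_fin mulr_ge0// ?pos_powR_ge0// indicE.
  - exact/measurable_EFinP.
  - rewrite -measurable_restrictT//; apply/measurable_EFinP.
    by apply: measurable_funTS; exact: measurable_powR.
  - move=> t _; rewrite -EFinM patchE indicE mem_setE.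
    case: ifPn => [|_]; last by rewrite mulr0.
    by rewrite in_itv/= => /andP[t0 _]; rewrite mulr1 pos_powR_gt0E.
under eq_integral do rewrite EFinM.
rewrite ge0_integralZl//=; last 2 first.
- exact/measurable_EFinP.
- by move=> t _; rewrite lee_fin mulr_ge0 ?expR_ge0// pos_powR_ge0.
apply: lte_mul_pinfty => //.
(* By scaling, egamma 1 = 1 is one half of this integral, which therefore is not infinite. *)
rewrite ltey; apply/eqP => oo.
have /= := @ge0_integral_affine R 2^-1 0 _ _ (measurable_egamma 1).
rewrite -/(egamma 1) egamma1 => /(_ _ _)/esym.
rewrite (@eq_integral _ _ _ _ _
    (fun t : RM => (pos_powR 1 t * expR (- (2^-1 * t + 0)))%:E)) ?oo.
  rewrite gt0_muley ?lte_fin ?invr_gt0// => h; have : +oo%E = 1%E :> \bar R.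
    by apply: h => // t; rewrite lee_fin mulr_ge0 ?expR_ge0// pos_powR_ge0.
  by move/(congr1 fine) => /= /eqP; rewrite eq_sym oner_eq0.
move=> t _; congr (_ * _)%:E; rewrite addr0; have [t0|t0] := leP t 0.
  by rewrite !pos_powR_le0E//; lra.
by rewrite !pos_powR_gt0E ?subrr ?powRr0//; lra.
Qed.

Lemma Gamma_funE p : 0 < p -> (Gamma_fun p)%:E = egamma p.
Proof.
move=> p0; rewrite /Gamma_fun /Rintegral integral_pos_powRE fineK// ge0_fin_numE.
  exact: egamma_lty.
by apply: integral_ge0 => t _; rewrite lee_fin mulr_ge0 ?expR_ge0// pos_powR_ge0.
Qed.

(** Only the part of the integral over [x, x + 1] is kept. Writing t^(p-1) as t^p / t gives one
    estimate for both signs of p - 1. *)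
Lemma Gamma_fun_ge p x : 0 < p -> 1 <= x ->
  x `^ p * (expR (- (x + 1)) / (x + 1)) <= Gamma_fun p.
Proof.
move=> p0 x1; have x0 : 0 < x by apply: lt_le_trans x1.
rewrite -lee_fin Gamma_funE// /egamma -integral_pos_powRE.
have muI : lebesgue_measure (`[x, x + 1]%classic : set R) = 1%E.
  rewrite lebesgue_measure_itv/= lte_fin ltrDl ltr01 -EFinB.
  by congr EFin; lra.
apply: (@le_trans _ _ (\int[mu]_(t in `[x, (x + 1)%R]) (t `^ (p - 1) * expR (- t))%:E)%E); last first.
  apply: ge0_subset_integral => //=.
  - by apply/measurable_EFinP/measurable_funTS/measurable_funM;
      [exact: measurable_powR|exact: measurable_expRN].
  - by move=> t _; rewrite lee_fin mulr_ge0 ?expR_ge0// powR_ge0.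
  - move=> t; rewrite /= !in_itv/= andbT => /andP[xt _]; exact: lt_le_trans xt.
have -> : (x `^ p * (expR (- (x + 1)) / (x + 1)))%:E =
    (\int[mu]_(t in `[x, (x + 1)%R]) (x `^ p * (expR (- (x + 1)) / (x + 1)))%:E)%E.
  by rewrite integral_cst//= [X in (_ * X)%E](_ : _ = 1%E) ?mule1//; exact: muI.
apply: ge0_le_integral => //=.
- by move=> t _; rewrite lee_fin !mulr_ge0 ?powR_ge0 ?expR_ge0// invr_ge0; lra.
- by apply/measurable_EFinP/measurable_funTS/measurable_funM;
    [exact: measurable_powR|exact: measurable_expRN].
- move=> t; rewrite /= in_itv/= => /andP[xt tx1]; rewrite lee_fin.
  have t0 : 0 < t by apply: lt_le_trans xt.
  rewrite mulrA mulrAC; apply: ler_pM.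
  + by rewrite divr_ge0 ?powR_ge0//; lra.
  + exact: expR_ge0.
  + have -> : t `^ (p - 1) = t `^ p / t.
      rewrite powRD ?powR_inv1 ?ltW//.
      by apply/implyP => _; rewrite gt_eqF.
    apply: ler_pM; rewrite ?powR_ge0// ?invr_ge0; first lra.
      by apply: ge0_ler_powR => //; rewrite ?nnegrE ltW.
    by rewrite lef_pV2 ?posrE//; lra.
  + by rewrite ler_expR lerN2.
Qed.

Lemma Gamma_fun_gt0 p : 0 < p -> 0 < Gamma_fun p.
Proof.
move=> p0; apply: lt_le_trans (Gamma_fun_ge p0 (lexx 1)).
by rewrite powR1 mul1r divr_gt0 ?expR_gt0//; lra.
Qed.

Lemma Gamma_fun1 : Gamma_fun (1 : R) = 1.
Proof. by apply: EFin_inj; rewrite Gamma_funE// egamma1. Qed.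

(** A convolution of truncated powers; at x = 1 it is the Beta integral B(p, q). *)
Definition beta_conv p q x : \bar R := (\int[mu]_s (pos_powR p s * pos_powR q (x - s))%:E)%E.

Lemma beta_conv_scale p q x : 0 < x ->
  beta_conv p q x = ((x `^ (p + q - 1))%:E * beta_conv p q 1)%E.
Proof.
move=> x0; rewrite /beta_conv (@ge0_integral_affine _ x 0)//; last 2 first.
- apply/measurable_EFinP; apply: measurable_funM; first exact: measurable_pos_powR.
  apply: measurableT_comp; first exact: measurable_pos_powR.
  exact: measurable_funB.
- by move=> s; rewrite lee_fin mulr_ge0 ?pos_powR_ge0.
have mb : measurable_fun setT (fun s : RM => (pos_powR p s * pos_powR q (1 - s))%:E).
  apply/measurable_EFinP; apply: measurable_funM; first exact: measurable_pos_powR.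
  apply: measurableT_comp; first exact: measurable_pos_powR.
  exact: measurable_funB.
have b0 (s : RM) : (0 <= (pos_powR p s * pos_powR q (1 - s))%:E)%E.
  by rewrite lee_fin mulr_ge0 ?pos_powR_ge0.
have scale r (s : R) : pos_powR r (x * s) = x `^ (r - 1) * pos_powR r s.
  have [s0|s0] := leP s 0.
    have xs : x * s <= 0 by rewrite pmulr_rle0.
    by rewrite !pos_powR_le0E ?mulr0.
  by rewrite !pos_powR_gt0E ?mulr_gt0// powRM// ltW.
under eq_integral => s _.
  rewrite addr0 -[X in X - x * s]mulr1 -mulrBr !scale mulrACA EFinM.
  over.
rewrite ge0_integralZl//=; last by rewrite lee_fin mulr_ge0 ?powR_ge0.
rewrite muleA -EFinM; congr (_%:E * _)%E.
rewrite -[X in X * _](powRr1 (ltW x0)) -!powRD; last 2 first.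
- by apply/implyP => _; rewrite gt_eqF.
- by apply/implyP => _; rewrite gt_eqF.
by congr (_ `^ _); lra.
Qed.

(* Multiplicative form of the Gamma-Beta relation: Tonelli on the double integral,
   with x = s + t as the outer variable, then the scaling of the Beta convolution. *)
Lemma egammaM p q : (egamma p * egamma q = egamma (p + q) * beta_conv p q 1)%E.
Proof.
have mq : measurable_fun setT (fun t : RM => (pos_powR q t * expR (- t))%:E).
  exact: measurable_egamma.
have pe0 r (t : R) : (0 <= (pos_powR r t * expR (- t))%:E)%E.
  by rewrite lee_fin mulr_ge0 ?expR_ge0// pos_powR_ge0.
have eq0 : (0 <= egamma q)%E by apply: integral_ge0 => t _; exact: pe0.
rewrite [X in (X * _)%E]/egamma -ge0_integralZr//=; last exact: measurable_egamma.
transitivity (\int[mu]_s \int[mu]_x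
    (pos_powR p s * pos_powR q (x - s) * expR (- x))%:E)%E.
  apply: eq_integral => s _; rewrite /egamma (@ge0_integral_affine _ 1 (- s) _ _ mq)// mul1e.
  have mqs : measurable_fun setT
      (fun x : RM => (pos_powR q (1 * x - s) * expR (- (1 * x - s)))%:E).
    by apply: (measurableT_comp mq); apply: measurable_funD => //; exact: measurable_funM.
  have qs0 (x : RM) : setT x -> (0 <= (pos_powR q (1 * x - s) * expR (- (1 * x - s)))%:E)%E.
    by move=> _; exact: pe0.
  rewrite -(ge0_integralZl mu measurableT mqs qs0 (pe0 p s)).
  apply: eq_integral => x _; rewrite -EFinM mul1r mulrACA -expRD; congr (_ * expR _)%:E.
  by lra.
pose f (z : RM * RM) : \bar R := (pos_powR p z.1 * pos_powR q (z.2 - z.1) * expR (- z.2))%:E.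
have mf : measurable_fun setT f.
  apply/measurable_EFinP; apply: measurable_funM; first apply: measurable_funM.
  - exact: measurableT_comp (measurable_pos_powR p) measurable_fst.
  - apply: measurableT_comp (measurable_pos_powR q) _.
    exact: measurable_funB measurable_snd measurable_fst.
  - exact: measurableT_comp measurable_expRN measurable_snd.
have f0 z : (0 <= f z)%E by rewrite /f lee_fin mulr_ge0 ?expR_ge0// mulr_ge0 ?pos_powR_ge0.
rewrite (@fubini_tonelli _ _ _ _ _ mu mu f mf f0) /f /=.
have b0 : (0 <= beta_conv p q 1)%E.
  by apply: integral_ge0 => s _; rewrite lee_fin mulr_ge0 ?pos_powR_ge0.
rewrite [X in (X * _)%E]/egamma -ge0_integralZr//=; last exact: measurable_egamma.
apply: eq_integral => x _; under eq_integral do rewrite EFinM.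
have mb : measurable_fun setT (fun s : RM => (pos_powR p s * pos_powR q (x - s))%:E).
  apply/measurable_EFinP; apply: measurable_funM; first exact: measurable_pos_powR.
  apply: measurableT_comp; first exact: measurable_pos_powR.
  exact: measurable_funB.
rewrite ge0_integralZr//=; last by move=> s _; rewrite lee_fin mulr_ge0 ?pos_powR_ge0.
rewrite -/(beta_conv p q x); have [x0|x0] := leP x 0.
  rewrite pos_powR_le0E// mul0r mul0e /beta_conv integral0_eq ?mul0e// => s _.
  have [s0|s0] := leP s 0; first by rewrite pos_powR_le0E ?mul0r.
  by rewrite (@pos_powR_le0E q) ?mulr0//; lra.
by rewrite beta_conv_scale// pos_powR_gt0E// EFinM muleAC.
Qed.

Lemma beta_integral p q t : 0 < p -> 0 < q -> 0 < t ->
  (\int[mu]_(s in `]0%R, t[) (s `^ (p - 1) * (t - s) `^ (q - 1))%:E =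
   (t `^ (p + q - 1) * (Gamma_fun p * Gamma_fun q / Gamma_fun (p + q)))%:E)%E.
Proof.
move=> p0 q0 t0.
have gpq := Gamma_fun_gt0 (addr_gt0 p0 q0).
transitivity (beta_conv p q t).
  rewrite integral_mkcond; apply: eq_integral => s _; rewrite patchE.
  case: ifPn; rewrite mem_setE in_itv/=.
    by move=> /andP[s0 st]; rewrite !pos_powR_gt0E// subr_gt0.
  rewrite negb_and -!leNgt => /orP[s0|ts]; first by rewrite pos_powR_le0E// mul0r.
  by rewrite (@pos_powR_le0E q) ?mulr0// subr_le0.
rewrite beta_conv_scale//; have := egammaM p q.
(* The product formula also excludes an infinite Beta integral: its left side is finite and the
   Gamma factor on its right is positive. *)
rewrite -!Gamma_funE ?addr_gt0//; case: (beta_conv p q 1) => [b||].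
- move=> [h]; rewrite -EFinM; congr (_ * _)%:E.
  by rewrite h mulrAC divff ?mul1r// gt_eqF.
- by rewrite gt0_muley ?lte_fin.
- by rewrite gt0_muleNy ?lte_fin.
Qed.

(** The Beta integral with p = q = t = 1 is the length of ]0, 1[ and equals 1 / Gamma(2). *)
Lemma Gamma_fun2 : Gamma_fun (2 : R) = 1.
Proof.
have := beta_integral (@ltr01 R) (@ltr01 R) (@ltr01 R).
rewrite Gamma_fun1 powR1 !mul1r.
under eq_integral do rewrite !subrr !powRr0 mulr1.
rewrite integral_cst//= lebesgue_measure_itv/= lte_fin ltr01 mul1e sube0 => -[h].
by apply: invr_inj; rewrite invr1 -h.
Qed.

End gamma_beta.

(** * Mittag-Leffler functions *)

Section mittag_leffler_series.
Context {R : realType}.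
Implicit Types (a d r x : R).

(* Gamma_fun p >= K x^p for every fixed x >= 1 (Gamma_fun_ge); choosing x with
   x^a = 2 r + 1 dominates the series by a geometric one of ratio 1/2. *)
Lemma mittag_leffler_nneg_cvg a d r : 0 < a -> 0 < d -> 0 <= r ->
  cvgn (series (fun j : nat => r ^+ j / Gamma_fun (a * j%:R + d))).
Proof.
move=> a0 d0 r0; pose x := (2 * r + 1) `^ a^-1.
have x1 : 1 <= x.
  have e1 : 1 `^ a^-1 = 1 :> R by rewrite powR1.
  rewrite -[leLHS]e1; apply: ge0_ler_powR; rewrite ?nnegrE ?invr_ge0 ?(ltW a0)//.
    by lra.
  by lra.
have x0 : 0 < x by apply: lt_le_trans x1.
have xa : x `^ a = 2 * r + 1.
  by rewrite /x -powRrM mulVf ?gt_eqF// powRr1//; lra.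
pose K := x `^ d * (expR (- (x + 1)) / (x + 1)).
have K0 : 0 < K.
  by apply: mulr_gt0; [exact: powR_gt0|apply: divr_gt0; [exact: expR_gt0|lra]].
have p0 j : 0 < a * j%:R + d by rewrite ltr_wpDl// mulr_ge0// ltW.
apply: (@series_le_cvg _ _ (geometric K^-1 2^-1)).
- by move=> j; rewrite divr_ge0 ?exprn_ge0// ltW// Gamma_fun_gt0.
- by move=> j; rewrite /geometric /= mulr_ge0 ?exprn_ge0// invr_ge0 ltW.
- move=> j; rewrite /geometric /= ler_pdivrMr ?Gamma_fun_gt0//.
  apply: (@le_trans _ _ (K^-1 * 2^-1 ^+ j * ((2 * r + 1) ^+ j * K))).
    rewrite [_ * K]mulrC mulrACA mulVf ?gt_eqF// mul1r -exprMn.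
    by rewrite lerXn2r ?nnegrE//; lra.
  apply: ler_wpM2l; first by rewrite mulr_ge0 ?exprn_ge0// invr_ge0 ltW.
  apply: le_trans (Gamma_fun_ge (p0 j) x1).
  rewrite /K mulrA ler_wpM2r//; first by rewrite divr_ge0 ?expR_ge0//; lra.
  by rewrite powRD ?powRrM ?xa ?powR_mulrn//; [lra|apply/implyP => _; rewrite gt_eqF].
- by apply: is_cvg_geometric_series; rewrite ger0_norm ?invr_ge0// invf_lt1// ltr1n.
Qed.

Lemma mittag_leffler_norm_cvg a d x : 0 < a -> 0 < d ->
  cvgn [normed series (fun j : nat => x ^+ j / Gamma_fun (a * j%:R + d))].
Proof.
move=> a0 d0; rewrite /normed_series_of /=.
rewrite (_ : (fun j => _) = (fun j => `|x| ^+ j / Gamma_fun (a * j%:R + d))).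
  exact: mittag_leffler_nneg_cvg.
apply/funext => j; rewrite normrM normrX normfV; congr (_ / _).
by rewrite ger0_norm// ltW// Gamma_fun_gt0// ltr_wpDl// mulr_ge0// ltW.
Qed.

Lemma mittag_leffler_cvg a d x : 0 < a -> 0 < d ->
  series (fun j : nat => x ^+ j / Gamma_fun (a * j%:R + d)) @ \oo -->
  mittag_leffler a d x.
Proof. by move=> a0 d0; apply: normed_cvg; exact: mittag_leffler_norm_cvg. Qed.

Lemma pseries_diffs_cvg (c : nat -> R) : (forall K, cvgn (pseries c K)) ->
  forall K, cvgn (pseries (pseries_diffs c) K).
Proof.
(* The factor 2 absorbs i + 1 <= 2^(i+1); the base |K| + 1 >= 1 gives |K|^i <= (|K| + 1)^(i+1). *)
move=> cc K; pose L := 2 * (`|K| + 1).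
have L0 : 0 <= L by rewrite mulr_ge0// addr_ge0.
pose v i := `|c i| * L ^+ i.
have cv : cvgn (series v).
  have := @is_cvg_pseries_inside_norm _ c (L + 1) L (cc _).
  by apply; rewrite !ger0_norm ?addr_ge0// ltrDl.
have cv1 : cvgn (series (fun i => v i.+1)).
  have -> : series (fun i => v i.+1) = (fun n => series v n.+1 - v 0%N).
    by apply/funext => n; rewrite /series /= big_nat_recl//= [X in X - _]addrC addrK.
  apply: is_cvgB; last exact: is_cvg_cst.
  by move/cvg_ex: cv => [l vl]; apply/cvg_ex; exists l; rewrite cvg_shiftS.
apply: normed_cvg; apply: series_le_cvg cv1 => //.
- by move=> i; exact: normr_ge0.
- by move=> i; rewrite /v mulr_ge0// exprn_ge0.
- move=> i; rewrite /pseries_diffs /= !normrM normrX normr_nat mulrAC [leRHS]mulrC ler_wpM2r//.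
  have h2 : i.+1%:R <= 2 ^+ i.+1 :> R by rewrite -natrX ler_nat ltnW// ltn_expl.
  rewrite /L exprMn ler_pM ?exprn_ge0// exprS -[leLHS]mul1r.
  by rewrite ler_pM ?exprn_ge0// ?lerDr// lerXn2r ?nnegrE ?addr_ge0// lerDl.
Qed.

(** A power series that converges everywhere is differentiable; [pseries_snd_diffs] asks for
    convergence of the series and of its first two formal derivatives. *)
Lemma continuous_mittag_leffler a d : 0 < a -> 0 < d ->
  continuous (mittag_leffler a d : R -> R).
Proof.
move=> a0 d0; pose c j := (Gamma_fun (a * j%:R + d))^-1.
have mlE : mittag_leffler a d = (fun x => limn (pseries c x)).
  apply/funext => x; rewrite /mittag_leffler /pseries; congr (limn (series _)).
  by apply/funext => j; rewrite mulrC.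
have cc K : cvgn (pseries c K).
  rewrite /pseries (_ : [sequence _]_i = (fun j => K ^+ j / Gamma_fun (a * j%:R + d))).
    by apply/cvg_ex; eexists; exact: mittag_leffler_cvg.
  by apply/funext => j; rewrite mulrC.
rewrite mlE => x.
have K1 : `|x| < `| `|x| + 1 | by rewrite [ltRHS]ger0_norm ?addr_ge0// ltrDl.
have c1 := pseries_diffs_cvg cc; have c2 := pseries_diffs_cvg c1.
have [dx _] := pseries_snd_diffs (cc _) (c1 _) (c2 _) K1.
by apply/differentiable_continuous/derivable1_diffP.
Qed.

(** The term j = 0 is split off. With x = - l t^a this recognizes the integral of [relaxation_deriv]
    as [relaxation] minus 1; for a = 1 it also gives the difference quotient at time 0. *)
Lemma mittag_leffler_shift a x : 0 < a ->
  mittag_leffler a 1 x = 1 + x * mittag_leffler a (a + 1) x.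
Proof.
move=> a0; have a10 : 0 < a + 1 by rewrite addr_gt0.
have h1 := @mittag_leffler_cvg a 1 x a0 ltr01.
have h2 := @mittag_leffler_cvg a (a + 1) x a0 a10.
rewrite -cvg_shiftS in h1; apply: (cvg_unique _ h1) => //.
have -> : [sequence series (fun j => x ^+ j / Gamma_fun (a * j%:R + 1)) n.+1]_n =
    (fun n => 1 + x * series (fun j => x ^+ j / Gamma_fun (a * j%:R + (a + 1))) n).
  apply/funext => n; rewrite /series /= big_nat_recl//= mulr0 add0r Gamma_fun1 expr0 divr1.
  congr (_ + _); rewrite mulr_sumr; apply: eq_bigr => j _.
  by rewrite exprS -mulrA -natr1 mulrDr mulr1 addrA.
by apply: cvgD; [exact: cvg_cst|apply: cvgM; [exact: cvg_cst|exact: h2]].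
Qed.

Lemma mittag_leffler0 a d : mittag_leffler a d 0 = (Gamma_fun d)^-1 :> R.
Proof.
apply/cvg_lim => //; rewrite -cvg_shiftS.
have -> : [sequence series (fun j => 0 ^+ j / Gamma_fun (a * j%:R + d)) n.+1]_n =
    (fun=> (Gamma_fun d)^-1 : R).
  apply/funext => n; rewrite /series /= big_nat_recl//= mulr0 add0r expr0 mul1r.
  by rewrite big1 ?addr0// => j _; rewrite expr0n mul0r.
exact: cvg_cst.
Qed.

End mittag_leffler_series.

(** * Termwise integration of series *)

Section integral_series.
Context d (T : measurableType d) {R : realType} (mu : {measure set T -> \bar R}).

(** Dominated convergence for the partial sums, with dominating function the sum of all [|f n|],
    whose integral is the sum of the [c n]. *)
Lemma integral_series (D : set T) (f : nat -> T -> R) (F : T -> R) (c : nat -> R) :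
  measurable D -> (forall n, measurable_fun D (f n)) ->
  (forall x, D x -> series (f^~ x) @ \oo --> F x) ->
  (forall n, \int[mu]_(x in D) `|f n x|%:E = (c n)%:E)%E -> cvgn (series c) ->
  mu.-integrable D (EFin \o F) /\
  series (fun n => \int[mu]_(x in D) f n x) @ \oo --> \int[mu]_(x in D) F x.
Proof.
move=> mD mf cF fc cc.
pose g x := (\sum_(n <oo) `|f n x|%:E)%E.
have mnf n : measurable_fun D (fun x => `|f n x|%:E).
  by apply/measurable_EFinP; exact: measurableT_comp (mf n).
have g0 x : (0 <= g x)%E by apply: nneseries_ge0.
have ig : mu.-integrable D g.
  apply/integrableP; split.
    by apply: (@ge0_emeasurable_sum _ _ _ _ _ xpredT).
  under eq_integral => x _ do rewrite gee0_abs//.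
  rewrite integral_nneseries//.
  under eq_eseriesr do rewrite fc.
  have -> : (\sum_(n <oo) (c n)%:E = (limn (series c))%:E)%E.
    rewrite -EFin_lim//; congr (limn _); apply/funext => n /=.
    by rewrite /series /= sumEFin.
  exact: ltry.
pose s n x := (series (f^~ x) n)%:E.
have ms n : measurable_fun D (s n).
  by apply/measurable_EFinP; apply: measurable_sum.
have mF : measurable_fun D F.
  by apply: (measurable_fun_cvg (h := fun n x => series (f^~ x) n)) => // n;
    exact/measurable_EFinP/ms.
have ifn n : mu.-integrable D (EFin \o f n).
  by apply/integrableP; split; [exact/measurable_EFinP|rewrite fc ltry].
have scv : {ae mu, forall x, D x -> s^~ x @ \oo --> (EFin \o F) x}.
  by apply: aeW => x Dx; apply: cvg_EFin; [exact: nearW|exact: cF].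
have sg : {ae mu, forall x n, D x -> (`|s n x| <= g x)%E}.
  apply: aeW => x n Dx.
  have -> : s n x = (\sum_(0 <= i < n) (f i x)%:E)%E by rewrite /s /series /= sumEFin.
  apply: le_trans (lee_abs_sum _ _ _) _.
  exact: nneseries_lim_ge.
have [iF _ cv] := dominated_convergence mD ms ((measurable_EFinP _ _).2 mF) scv ig sg.
split => //.
have -> : series (fun n => \int[mu]_(x in D) f n x) =
    fine \o (fun n => \int[mu]_(x in D) s n x)%E.
  apply/funext => n /=; rewrite /s /series /=.
  under eq_integral do rewrite -sumEFin.
  rewrite integral_sum//.
  rewrite sum_fine// => k _; exact: integrable_fin_num (ifn k).
by apply: fine_cvg; rewrite fineK//; exact: integrable_fin_num iF.
Qed.

End integral_series.

(** * Fractional integrals of the relaxation derivative *)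

Section mittag_leffler_convolution.
Context {R : realType}.
Let mu : {measure set (measurableTypeR R) -> \bar R} := lebesgue_measure.
Notation RM := (measurableTypeR R).

Variables (a l : R).
Hypotheses (a0 : 0 < a) (l0 : 0 < l).

Definition relaxation_deriv (s : R) : R :=
  - l * s `^ (a - 1) * mittag_leffler a a (- l * s `^ a).

Lemma measurable_beta_kernel p q t :
  measurable_fun setT (fun s : RM => s `^ (p - 1) * (t - s) `^ (q - 1)).
Proof.
apply: measurable_funM; first exact: measurable_powR.
by apply: (measurableT_comp (measurable_powR _)); exact: measurable_funB.
Qed.

(** One computation serves two purposes: q = 1 gives the increments of the relaxation function, q =
    1 - a its Caputo integral. *)
Lemma relaxation_deriv_integral (q t : R) : 0 < q -> 0 < t ->
  mu.-integrable `]0, t[ (EFin \o (fun s => relaxation_deriv s * (t - s) `^ (q - 1))) /\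
  \int[mu]_(s in `]0, t[) (relaxation_deriv s * (t - s) `^ (q - 1)) =
  - l * Gamma_fun q * t `^ (a + q - 1) * mittag_leffler a (a + q) (- l * t `^ a).
Proof.
move=> q0 t0; pose p j : R := a * j%:R + a.
have p0 j : 0 < p j by rewrite ltr_wpDl// mulr_ge0// ltW.
pose B j (s : R) := s `^ (p j - 1) * (t - s) `^ (q - 1).
have B0 j s : 0 <= B j s by rewrite mulr_ge0 ?powR_ge0.
have mB j : measurable_fun `]0, t[ (B j) by apply: measurable_funTS; exact: measurable_beta_kernel.
pose k j := (- l) ^+ j.+1 / Gamma_fun (p j).
have powE (s : R) j r : 0 < s -> s `^ (a * j%:R + r) = (s `^ a) ^+ j * s `^ r.
  move=> s0; rewrite powRD ?powRrM ?powR_mulrn ?powR_ge0//.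
  by apply/implyP => _; rewrite gt_eqF.
have intB j : (\int[mu]_(s in `]0%R, t[) (B j s)%:E =
    ((t `^ a) ^+ j * t `^ (a + q - 1) *
      (Gamma_fun (p j) * Gamma_fun q / Gamma_fun (a * j%:R + (a + q))))%:E)%E.
  have pq : p j + q = a * j%:R + (a + q) by rewrite /p addrA.
  by rewrite (beta_integral (p0 j) q0 t0) pq -addrA powE.
have iB j : mu.-integrable `]0, t[ (EFin \o B j).
  apply/integrableP; split; first by apply/measurable_EFinP; exact: mB.
  under eq_integral => s _ do rewrite /= ger0_norm//.
  by rewrite intB ltry.
pose f j s := k j * B j s.
pose C := l * Gamma_fun q * t `^ (a + q - 1).
have mf j : measurable_fun `]0, t[ (f j) by exact: measurable_funM.
have cF s : `]0, t[%classic s ->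
    series (f^~ s) @ \oo --> relaxation_deriv s * (t - s) `^ (q - 1).
  rewrite /= in_itv/= => /andP[s0 st].
  have -> : series (f^~ s) = (fun n => - l * s `^ (a - 1) *
      series (fun j => (- l * s `^ a) ^+ j / Gamma_fun (a * j%:R + a)) n *
      (t - s) `^ (q - 1)).
    apply/funext => n; rewrite /series /= mulr_sumr mulr_suml; apply: eq_bigr => j _.
    rewrite /f /B /k /p -addrA powE// exprMn exprS; lra.
  apply: cvgM; last exact: cvg_cst.
  by apply: cvgM; [exact: cvg_cst|exact: mittag_leffler_cvg].
have normk j : `|k j| = l ^+ j.+1 / Gamma_fun (p j).
  by rewrite /k normrM normrX normrN (gtr0_norm l0) normfV gtr0_norm// Gamma_fun_gt0.
have gp j : Gamma_fun (p j) != 0 by rewrite gt_eqF// Gamma_fun_gt0.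
have gpq j : Gamma_fun (a * j%:R + (a + q)) != 0.
  by rewrite gt_eqF// Gamma_fun_gt0// addrA addr_gt0// p0.
have alg (x y g h z w G : R) : g != 0 -> G != 0 ->
    x * y / g * (z * w * (g * h / G)) = x * h * w * (y * z / G).
  by move=> g0 G0; field; rewrite g0 G0.
(* Absolute values replace - l by l, so the norms sum to a multiple of the Mittag-Leffler series at
   l t^a; the Gamma factor of [k j] cancels against the Beta integral. *)
have fc j : (\int[mu]_(s in `]0%R, t[) `|f j s|%:E =
    (C * ((l * t `^ a) ^+ j / Gamma_fun (a * j%:R + (a + q))))%:E)%E.
  under eq_integral => s _ do rewrite /f normrM normk (ger0_norm (B0 _ _)) EFinM.
  rewrite ge0_integralZl//=; last 3 first.
  - by apply/measurable_EFinP; exact: mB.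
  - by move=> s _; rewrite lee_fin.
  - by rewrite lee_fin divr_ge0 ?exprn_ge0 ?ltW ?Gamma_fun_gt0.
  by rewrite intB -EFinM /C exprMn exprS alg.
have cc : cvgn (series (fun j => C * ((l * t `^ a) ^+ j / Gamma_fun (a * j%:R + (a + q))))).
  apply: is_cvg_seriesZ; apply: mittag_leffler_nneg_cvg; rewrite ?addr_gt0//.
  by rewrite mulr_ge0 ?powR_ge0// ltW.
have [iF cv] := @integral_series _ _ R mu `]0, t[%classic f
  (fun s => relaxation_deriv s * (t - s) `^ (q - 1)) _ (measurable_itv _) mf cF fc cc.
split => //; apply: (cvg_unique _ cv) => //.
have -> : series (fun n => \int[mu]_(x in `]0, t[) f n x) = (fun n =>
   - l * Gamma_fun q * t `^ (a + q - 1) *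
    series (fun j => (- l * t `^ a) ^+ j / Gamma_fun (a * j%:R + (a + q))) n).
  apply/funext => n; rewrite /series /= mulr_sumr; apply: eq_bigr => j _.
  rewrite /f RintegralZl// /Rintegral intB /= /k exprMn exprS alg//.
by apply: cvgM; [exact: cvg_cst|apply: mittag_leffler_cvg => //; rewrite addr_gt0].
Qed.

End mittag_leffler_convolution.

(** * Maximum principle *)

Section kernel_positivity.
Context {R : realType}.
Let mu : {sigma_finite_measure set (measurableTypeR R) -> \bar R} := lebesgue_measure.
Notation RM := (measurableTypeR R).

Lemma is_derive_powR_sub (a t r : R) : r < t ->
  is_derive r 1 (fun r => (t - r) `^ (- a)) (a * (t - r) `^ (- a - 1)).
Proof.
move=> rt; have tr : 0 < t - r by rewrite subr_gt0.
have h1 := is_derive1_powR (- a) tr.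
have h2 : is_derive r 1 (fun r : R => t - r) (- 1).
  have h : is_derive r 1 (cst t - id) (0 - 1 : R) by exact: is_deriveB.
  by move: h; rewrite sub0r.
have h3 := @is_derive1_comp _ (fun x => x `^ (- a)) (fun r => t - r) r _ _ h1 h2.
by move: h3; rewrite mulrN1 mulNr opprK.
Qed.

Lemma integral_powR_sub (a t s : R) : 0 < s -> s < t ->
  (\int[mu]_(r in `[0%R, s]) (a * (t - r) `^ (- a - 1))%:E =
   ((t - s) `^ (- a) - t `^ (- a))%:E)%E.
Proof.
move=> s0 st; pose G r := (t - r) `^ (- a).
have dG r : r < t -> is_derive r 1 G (a * (t - r) `^ (- a - 1)).
  exact: is_derive_powR_sub.
have cG r : r < t -> {for r, continuous G}.
  by move=> rt; apply/differentiable_continuous/derivable1_diffP; have [] := dG r rt.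
rewrite (@continuous_FTC2 _ _ G)//.
- by rewrite -EFinB /G subr0.
- apply: derivable_within_continuous => r /[!in_itv]/= /andP[_ rs].
  have [h _] := is_derive_powR_sub (a + 1) (le_lt_trans rs st).
  apply: derivableM; first exact: derivable_cst.
  by move: h; rewrite opprD.
- split.
  + by move=> r /[!in_itv]/= /andP[_ rs]; have [] := dG r (lt_trans rs st).
  + by apply: cvg_at_right_filter; apply: cG; exact: lt_trans st.
  + by apply: cvg_at_left_filter; exact: cG.
- move=> r /[!in_itv]/= /andP[_ rs]; rewrite derive1E.
  by have [_ ->] := dG r (lt_trans rs st).
Qed.

(* Layer cake: (t - s)^-a = t^-a + int_0^s a (t - r)^(-a-1) dr turns the
   weighted integral into a positive combination of the tail integrals of phi. *)
Lemma integral_kernel_ge0 (a t : R) (phi : R -> R) : 0 < a -> 0 < t ->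
  mu.-integrable `]0, t[ (EFin \o phi) ->
  mu.-integrable `]0, t[ (EFin \o (fun s => phi s * (t - s) `^ (- a))) ->
  (forall r, 0 <= r < t -> 0 <= \int[mu]_(s in `]r, t[) phi s) ->
  0 <= \int[mu]_(s in `]0, t[) (phi s * (t - s) `^ (- a)).
Proof.
move=> a0 t0 iphi ik tail.
have mS : measurable (`]0, t[%classic : set RM) by exact: measurable_itv.
pose P (s : RM) : R := (phi \_ `]0, t[%classic) s.
pose w (r : RM) : R := a * (t - r) `^ (- a - 1).
(* The constraints 0 < r and r < s become factors, so that Fubini runs over the whole plane. *)
pose pos : RM -> R := \1_(`]0, +oo[%classic : set RM).
have posE (r : R) : pos r = (0 < r)%R%:R by rewrite /pos indicE mem_setE in_itv/= andbT.
have pos0 (r : R) : 0 <= pos r by rewrite posE.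
have w0 r : 0 <= w r by rewrite mulr_ge0 ?powR_ge0// ltW.
have mP : measurable_fun setT P.
  have /integrableP[/measurable_EFinP m _] := iphi.
  exact: ((@measurable_restrictT _ _ RM RM `]0, t[%classic phi mS).1 m).
have mw : measurable_fun setT w.
  apply: measurable_funM => //; apply: (measurableT_comp (measurable_powR _)).
  exact: measurable_funB.
have mpos : measurable_fun setT pos by apply: measurable_indic; exact: measurable_itv.
pose F (z : RM * RM) : \bar R := (P z.1 * (w z.2 * pos z.2 * pos (z.1 - z.2)))%:E.
have mF : measurable_fun setT F.
  apply/measurable_EFinP; apply: measurable_funM; first exact: measurableT_comp mP measurable_fst.
  apply: measurable_funM; first apply: measurable_funM.
  - exact: measurableT_comp mw measurable_snd.
  - exact: measurableT_comp mpos measurable_snd.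
  - apply: (measurableT_comp mpos).
    exact: measurable_funB measurable_fst measurable_snd.
have mws s : measurable_fun setT (fun r : RM => (w r * pos r * pos (s - r))%:E).
  apply/measurable_EFinP; apply: measurable_funM; first exact: measurable_funM.
  by apply: (measurableT_comp mpos); exact: measurable_funB.
have ws0 s (r : RM) : (0 <= (w r * pos r * pos (s - r))%:E)%E.
  by rewrite lee_fin mulr_ge0// mulr_ge0.
(* The varying part of the weight; the constant part t^(-a) is added back at the end and handled by
   the tail at r = 0. *)
pose k s := (t - s) `^ (- a) - t `^ (- a).
have inner s : 0 < s -> s < t -> (\int[mu]_r (w r * pos r * pos (s - r))%:E = (k s)%:E)%E.
  move=> s0 st; rewrite -integral_powR_sub//.
  rewrite (@integral_itv_bndoo _ 0 s _ true false); last first.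
    by apply/measurable_EFinP; exact: measurable_funTS.
  rewrite [RHS]integral_mkcond; apply: eq_integral => r _; rewrite patchE.
  rewrite mem_setE in_itv/= !posE subr_gt0.
  by case: (0 < r); case: (r < s); rewrite /= ?mulr1 ?mulr0.
have k0 s : 0 < s -> s < t -> 0 <= k s.
  by move=> s0 st; rewrite -lee_fin -inner//; apply: integral_ge0.
have PoutE s : ~~ (0 < s < t) -> P s = 0.
  by move=> h; rewrite /P patchE memNset//= in_itv/=; exact/negP.
have PinE s : 0 < s < t -> P s = phi s.
  by move=> h; rewrite /P patchE mem_set//= in_itv/=.
have iPk : mu.-integrable setT (EFin \o (fun s => P s * k s)).
  have -> : EFin \o (fun s => P s * k s) =
      (EFin \o (fun s => phi s * (t - s) `^ (- a) - t `^ (- a) * phi s)) \_ `]0, t[%classic.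
    apply/funext => s; rewrite patchE mem_setE in_itv/=.
    have [h|h] := boolP (0 < s < t); last by rewrite PoutE// mul0r.
    by rewrite PinE// /k mulrBr [phi s * t `^ _]mulrC.
  apply/(integrable_mkcond _ mS).1.
  have i1 : mu.-integrable `]0, t[ (EFin \o (fun s => t `^ (- a) * phi s)).
    exact: eq_integrable (integrableZl mS (t `^ (- a)) iphi).
  exact: eq_integrable (integrableB mS ik i1).
have FE s : (\int[mu]_r F (s, r) = (P s * k s)%:E)%E.
  rewrite /F /=; have [/andP[s0 st]|h] := boolP (0 < s < t); last first.
    by rewrite PoutE// mul0r integral0_eq// => r _; rewrite mul0r.
  under eq_integral do rewrite EFinM.
  rewrite integralZl//; last first.
    by apply/integrableP; split => //; under eq_integral do rewrite gee0_abs//; rewrite inner// ltry.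
  by rewrite inner.
have iF : (mu \x mu)%E.-integrable setT F.
  apply: (integrable12ltyP mu mu mF).2.
  have /integrableP[_] := iPk; apply: le_lt_trans; rewrite le_eqVlt; apply/orP; left; apply/eqP.
  apply: eq_integral => s _; rewrite /F /=; have [/andP[s0 st]|h] := boolP (0 < s < t); last first.
    by rewrite PoutE// mul0r normr0 integral0_eq// => r _; rewrite mul0r normr0.
  rewrite normrM (ger0_norm (k0 _ s0 st)) EFinM -inner// -ge0_integralZl//.
  apply: eq_integral => r _; rewrite normrM EFinM.
  by rewrite (ger0_norm (_ : 0 <= w r * pos r * pos (s - r)))// mulr_ge0// mulr_ge0.
have main : (0 <= \int[mu]_s (P s * k s)%:E)%E.
  (* After the exchange, the inner integral at fixed r in ]0, t[ is [w r] times the tail integral of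
     [phi] over ]r, t[; for other r it vanishes. *)
  under eq_integral => s _ do rewrite -FE.
  rewrite (Fubini iF); apply: integral_ge0 => r _; rewrite /F /=.
  have [r0|r0] := leP r 0.
    rewrite integral0_eq// => s _; rewrite posE.
    have -> : (0 < r) = false by apply/negbTE; rewrite -leNgt.
    by rewrite mulr0 mul0r mulr0.
  have [tr|rt] := leP t r.
    rewrite integral0_eq// => s _; have [/andP[s0 st]|h] := boolP (0 < s < t); last by rewrite PoutE// mul0r.
    rewrite [pos (s - r)]posE subr_gt0.
    have -> : (r < s) = false; last by rewrite !mulr0.
    by apply/negbTE; rewrite -leNgt (le_trans (ltW st)).
  have -> : (\int[mu]_s (P s * (w r * pos r * pos (s - r)))%:E =
      (w r)%:E * \int[mu]_(s in `]r, t[) (phi s)%:E)%E.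
    rewrite -integralZl//; last first.
      apply: integrableS iphi => //; apply: subset_itvr; rewrite bnd_simp; exact: ltW.
    rewrite [RHS]integral_mkcond; apply: eq_integral => s _; rewrite patchE mem_setE in_itv/=.
    rewrite !posE r0 mulr1 subr_gt0; case: (ltP r s) => rs /=; last by rewrite !mulr0.
    case: (ltP s t) => st; first by rewrite PinE ?st ?(lt_trans r0 rs)// mulr1 EFinM muleC.
    by rewrite PoutE ?mul0r//; rewrite negb_and -!leNgt st orbT.
  rewrite mule_ge0 ?lee_fin//.
  have := tail r; rewrite (ltW r0) rt => /(_ isT); rewrite /Rintegral -lee_fin fineK//.
  apply: integrable_fin_num => //; apply: integrableS iphi => //.
  by apply: subset_itvr; rewrite bnd_simp; exact: ltW.
have -> : \int[mu]_(s in `]0, t[) (phi s * (t - s) `^ (- a)) =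
    fine (\int[mu]_s (P s * k s)%:E)%E + t `^ (- a) * \int[mu]_(s in `]0, t[) phi s.
  rewrite -RintegralZl// -[fine _]/(Rintegral mu setT (fun s => P s * k s)).
  have -> : Rintegral mu setT (fun s => P s * k s) =
     \int[mu]_(s in `]0, t[) (phi s * k s).
    rewrite [RHS]Rintegral_mkcond; apply: eq_Rintegral => s _.
    rewrite patchE mem_setE in_itv/=.
    by have [h|h] := boolP (0 < s < t); [rewrite PinE|rewrite PoutE// mul0r].
  have iphik : mu.-integrable `]0, t[ (EFin \o (fun s => phi s * k s)).
    apply: eq_integrable (integrableS measurableT mS (@subsetT _ _) iPk) => // s.
    by rewrite mem_setE in_itv/= => h; rewrite /= PinE.
  have i1 : mu.-integrable `]0, t[ (EFin \o (fun s => t `^ (- a) * phi s)).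
    exact: eq_integrable (integrableZl mS (t `^ (- a)) iphi).
  rewrite -RintegralD//; apply: eq_Rintegral => s _.
  by rewrite /k mulrBr [t `^ _ * _]mulrC subrK.
apply: addr_ge0; first exact: fine_ge0.
by rewrite mulr_ge0 ?powR_ge0//; apply: tail; rewrite lexx.
Qed.

End kernel_positivity.

(** * Comparison of solutions *)

Section comparison.
Context {R : realType}.
Let mu : {measure set (measurableTypeR R) -> \bar R} := lebesgue_measure.
Notation RM := (measurableTypeR R).

Lemma is_derive_left_max (w : R -> R) (x D : R) : is_derive x 1 w D ->
  (\forall y \near x^'-, w y <= w x) -> 0 <= D.
Proof.
move=> /is_derive1_caratheodory[g [wg cg <-]] wmax.
have gx : g y @[y --> x^'-] --> g x by exact: cvg_at_left_filter.
rewrite -(cvg_lim _ gx)//; apply: limr_ge; first by apply/cvg_ex; exists (g x).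
near=> y; have yx : y < x by near: y; exact: nbhs_left_lt.
have : w y <= w x by near: y.
by rewrite -subr_le0 wg nmulr_lle0// subr_lt0.
Unshelve. all: by end_near. Qed.

Lemma is_derive_right_max (w : R -> R) (x D : R) : is_derive x 1 w D ->
  (\forall y \near x^'+, w y <= w x) -> D <= 0.
Proof.
move=> /is_derive1_caratheodory[g [wg cg <-]] wmax.
have gx : g y @[y --> x^'+] --> g x by exact: cvg_at_right_filter.
rewrite -(cvg_lim _ gx)//; apply: limr_le; first by apply/cvg_ex; exists (g x).
near=> y; have yx : x < y by near: y; exact: nbhs_right_gt.
have : w y <= w x by near: y.
by rewrite -subr_le0 wg pmulr_lle0// subr_gt0.
Unshelve. all: by end_near. Qed.

(** From a nonzero point of the segment, moving towards 0 stays inside, even from an endpoint. The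
    one-sided comparison on that side gives the derivative the sign of x. *)
Lemma is_derive_max_segment (w : R -> R) (M x D : R) : is_derive x 1 w D ->
  0 < M -> `|x| <= M -> (forall y, `|y| <= M -> w y <= w x) -> 0 <= x * D.
Proof.
move=> dw M0; rewrite ler_norml => /andP[Mx xM] wmax.
have [x0|x0|->] := ltgtP x 0; last by rewrite mul0r.
- rewrite nmulr_rge0//; apply: is_derive_right_max dw _; near=> y; apply: wmax.
  have xy : x < y by near: y; exact: nbhs_right_gt.
  have y0 : y < 0 by near: y; exact: nbhs_right_lt.
  by rewrite ler_norml; apply/andP; split; lra.
- rewrite pmulr_rge0//; apply: is_derive_left_max dw _; near=> y; apply: wmax.
  have yx : y < x by near: y; exact: nbhs_left_lt.
  have y0 : 0 < y by near: y; exact: nbhs_left_gt.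
  by rewrite ler_norml; apply/andP; split; lra.
Unshelve. all: by end_near. Qed.

(** Maximality makes every left difference quotient of v1 - v2 at t at least [e]. Since t > 0, left
    neighbours of t are admissible times. *)
Lemma caputo_lt_max_eq1 (e t : R) (v1 v2 : R -> R) : 0 < e -> 0 < t ->
  caputo_derivable 1 v1 -> caputo_derivable 1 v2 ->
  (forall r, 0 <= r <= t -> v1 r - v2 r - e * r <= v1 t - v2 t - e * t) ->
  caputo 1 v2 t < caputo 1 v1 t.
Proof.
move=> e0 t0; rewrite /caputo_derivable /caputo eqxx => d1 d2 vmax.
have sub : t^'- --> time_punctured_nbhs t.
  move=> P hP.
  have h1 : nbhs t (fun y => y != t -> `[0, +oo[%classic y -> P y) by exact: hP.
  have h2 : nbhs t (fun y => y < t -> P y).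
    have p0 : nbhs t (fun y => 0 < y) by exact: lt_nbhsr.
    apply: filterS2 h1 p0 => y h y0 yt; apply: h; first by rewrite lt_eqF.
    by rewrite /= in_itv/= andbT ltW.
  exact: h2.
have c1 : time_quotient v1 t s @[s --> t^'-] --> lim (time_quotient v1 t @ time_punctured_nbhs t).
  by apply: cvg_trans (d1 t (ltW t0)); exact: cvg_app.
have c2 : time_quotient v2 t s @[s --> t^'-] --> lim (time_quotient v2 t @ time_punctured_nbhs t).
  by apply: cvg_trans (d2 t (ltW t0)); exact: cvg_app.
have c12 : (time_quotient v1 t - time_quotient v2 t) s @[s --> t^'-] -->
    lim (time_quotient v1 t @ time_punctured_nbhs t) -
    lim (time_quotient v2 t @ time_punctured_nbhs t) by exact: cvgB.
suff : e <= lim (time_quotient v1 t @ time_punctured_nbhs t) -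
    lim (time_quotient v2 t @ time_punctured_nbhs t) by lra.
rewrite -(cvg_lim _ c12)//; apply: limr_ge; first by apply/cvg_ex; eexists; exact: c12.
near=> s; have st : s < t by near: s; exact: nbhs_left_lt.
have s0 : 0 < s by near: s; exact: nbhs_left_gt.
change (e <= time_quotient v1 t s - time_quotient v2 t s).
rewrite /time_quotient -mulrBl ler_ndivlMr ?subr_lt0//.
have := vmax s; rewrite (ltW s0) (ltW st) => /(_ isT) h.
set a := v1 s in h *; set b := v2 s in h *; set c := v1 t in h *; set d := v2 t in h *.
by lra.
Unshelve. all: by end_near. Qed.

Lemma caputo_kernel_ftc (a t : R) (v : R -> R) : a < 1 -> 0 < t ->
  caputo_derivable a v ->
  [/\ mu.-integrable `]0, t[ (EFin \o derive1 v),
      mu.-integrable `]0, t[ (EFin \o (fun s => derive1 v s * (t - s) `^ (- a))),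
      caputo a v t = (Gamma_fun (1 - a))^-1 *
        \int[mu]_(s in `]0, t[) (derive1 v s * (t - s) `^ (- a)) &
      forall r, 0 <= r < t -> \int[mu]_(s in `]r, t[) derive1 v s = v t - v r].
Proof.
move=> a1 t0; rewrite /caputo_derivable lt_eqF// => -[acv ikv _].
have mS : measurable (`]0, t[%classic : set RM) by exact: measurable_itv.
have ik : mu.-integrable `]0, t[ (EFin \o caputo_kernel a v t).
  apply: integrableS (ikv t t0) => //.
  by apply: subset_itv; rewrite bnd_simp.
have ik' : mu.-integrable `]0, t[ (EFin \o (fun s => derive1 v s * (t - s) `^ (- a))).
  by apply: eq_integrable ik => // s _; rewrite /= /caputo_kernel powRN.
(* Multiplying the measurable kernel by (t - s)^a recovers the derivative on the open interval. *)
have mv' : measurable_fun `]0, t[ (derive1 v).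
  have /integrableP[/measurable_EFinP mk _] := ik.
  have mp : measurable_fun `]0, t[ (fun s : RM => (t - s) `^ a).
    apply: measurable_funTS; apply: (measurableT_comp (measurable_powR _)).
    exact: measurable_funB.
  apply: eq_measurable_fun (measurable_funM mk mp) => s.
  rewrite mem_setE in_itv/= => /andP[s0 st]; rewrite /caputo_kernel divfK//.
  by rewrite gt_eqF// powR_gt0// subr_gt0.
have [iv' ftc] := abs_continuous_ftc t0 (acv t t0) mv'.
split => //.
- rewrite /caputo lt_eqF// gt_eqF// /caputo_integral; congr (_ * _).
  have /integrableP[mk _] := ik.
  rewrite /Rintegral (@integral_itv_bndoo _ 0 t _ true false)//; congr fine.
  by apply: eq_integral => s _; rewrite /= /caputo_kernel powRN.
- move=> r /andP[]; rewrite le_eqVlt => /predU1P[<-|r0] rt.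
    by rewrite ftc// lexx ltW.
  have ax : (BRight 0 <= BRight r)%O by rewrite bnd_simp ltW.
  have xb : (BRight r <= BLeft t)%O by rewrite bnd_simp.
  rewrite -(Rintegral_itvB iv' ax xb) -Rintegral_itv_bndo_bndc; last first.
    by apply: integrableS iv' => //; apply: subset_itvl; rewrite bnd_simp ltW.
  rewrite ftc ?(ltW t0) ?lexx// ftc ?(ltW r0) ?ltW//.
  by rewrite opprB addrA subrK.
Qed.

(** Kernel positivity is applied to v1' - v2' - e, whose tail integrals are nonnegative by
    maximality. It leaves a gap of e B, where B > 0 is the integral of (t - s)^(-a) over ]0, t[, a
    Beta integral with p = 1. *)
Lemma caputo_lt_max_lt1 (a e t : R) (v1 v2 : R -> R) : 0 < a -> a < 1 -> 0 < e -> 0 < t ->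
  caputo_derivable a v1 -> caputo_derivable a v2 ->
  (forall r, 0 <= r <= t -> v1 r - v2 r - e * r <= v1 t - v2 t - e * t) ->
  caputo a v2 t < caputo a v1 t.
Proof.
move=> a0 a1 e0 t0 d1 d2 vmax.
have [i1 k1 -> f1] := caputo_kernel_ftc a1 t0 d1.
have [i2 k2 -> f2] := caputo_kernel_ftc a1 t0 d2.
have mS : measurable (`]0, t[%classic : set RM) by exact: measurable_itv.
have q0 : 0 < 1 - a by rewrite subr_gt0.
have betaE := beta_integral (@ltr01 R) q0 t0.
pose K s := (t - s) `^ (- a).
pose B := t `^ (1 + (1 - a) - 1) * (Gamma_fun 1 * Gamma_fun (1 - a) / Gamma_fun (1 + (1 - a))).
have B0 : 0 < B.
  by rewrite mulr_gt0 ?powR_gt0// divr_gt0 ?mulr_gt0 ?Gamma_fun_gt0// addr_gt0.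
have KE : (\int[mu]_(s in `]0%R, t[) (K s)%:E = B%:E)%E.
  rewrite /B -betaE; apply: eq_integral => s _.
  rewrite (subrr (1 : R)) powRr0 mul1r /K; congr (_ `^ _)%:E.
  by rewrite addrAC subrr add0r.
clear betaE.
have mK : measurable_fun `]0, t[ (K : RM -> R).
  apply: measurable_funTS; apply: (measurableT_comp (measurable_powR _)).
  exact: measurable_funB.
have iK : mu.-integrable `]0, t[ (EFin \o K).
  apply/integrableP; split; first by apply/measurable_EFinP; exact: mK.
  under eq_integral => s _ do rewrite /= ger0_norm ?powR_ge0//.
  by rewrite KE ltry.
have ie : mu.-integrable `]0, t[ (EFin \o (fun s => e * K s)).
  exact: eq_integrable (integrableZl mS e iK).
have ic (r : R) : 0 <= r -> mu.-integrable `]r, t[ (EFin \o (cst e : RM -> R)).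
  move=> r0; apply: measurable_bounded_integrable => //=.
  - by rewrite lebesgue_measure_itv/=; case: ifP => // _; rewrite -EFinB ltry.
  - by exists `|e|; split; [exact: num_real|move=> M eM s _; exact: ltW].
pose phi s := derive1 v1 s - derive1 v2 s - e.
have i12 := integrableB mS i1 i2.
have iphi : mu.-integrable `]0, t[ (EFin \o phi).
  exact: eq_integrable (integrableB mS i12 (ic 0 (lexx 0))).
have k12 := integrableB mS k1 k2.
have k12' : mu.-integrable `]0, t[
    (EFin \o (fun s => derive1 v1 s * (t - s) `^ (- a) - derive1 v2 s * (t - s) `^ (- a))).
  exact: eq_integrable k12.
have phiK : mu.-integrable `]0, t[ (EFin \o (fun s => phi s * (t - s) `^ (- a))).
  apply: eq_integrable (integrableB mS k12 ie) => // s _.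
  by rewrite /= /phi !mulrBl.
have tail r : 0 <= r < t -> 0 <= \int[mu]_(s in `]r, t[) phi s.
  move=> /[dup] rt /andP[r0 rlt].
  have sub : `]r, t[ `<=` (`]0, t[%classic : set R).
    by apply: subset_itvr; rewrite bnd_simp.
  have mr : measurable (`]r, t[%classic : set RM) by exact: measurable_itv.
  have i1r := integrableS mS mr sub i1.
  have i2r := integrableS mS mr sub i2.
  have i12r : mu.-integrable `]r, t[ (EFin \o (fun s => derive1 v1 s - derive1 v2 s)).
    exact: eq_integrable (integrableB mr i1r i2r).
  rewrite /phi (RintegralB mr i12r (ic r r0)) (RintegralB mr i1r i2r) (f1 r rt) (f2 r rt).
  rewrite Rintegral_cst//= lebesgue_measure_itv/= lte_fin rlt -EFinB /=.
  have := vmax r; rewrite r0 (ltW rlt) => /(_ isT).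
  move: (v1 r) (v2 r) (v1 t) (v2 t) => p q p' q'; nra.
have := integral_kernel_ge0 a0 t0 iphi phiK tail.
have -> : \int[mu]_(s in `]0, t[) (phi s * (t - s) `^ (- a)) =
    \int[mu]_(s in `]0, t[) (derive1 v1 s * (t - s) `^ (- a)) -
    \int[mu]_(s in `]0, t[) (derive1 v2 s * (t - s) `^ (- a)) - e * B.
  have -> : e * B = \int[mu]_(s in `]0, t[) (e * K s).
    by rewrite (RintegralZl e mS iK) /Rintegral KE.
  rewrite -(RintegralB mS k1 k2) -(RintegralB mS k12' ie); apply: eq_Rintegral => s _.
  by rewrite /phi !mulrBl.
have eB : 0 < e * B by rewrite mulr_gt0.
rewrite ltr_pM2l ?invr_gt0 ?Gamma_fun_gt0//.
move: (Rintegral _ _ _) (Rintegral _ _ _) => X1 X2.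
by clear -eB; lra.
Qed.

Lemma caputo_lt_max (a e t : R) (v1 v2 : R -> R) : 0 < a -> a <= 1 -> 0 < e -> 0 < t ->
  caputo_derivable a v1 -> caputo_derivable a v2 ->
  (forall r, 0 <= r <= t -> v1 r - v2 r - e * r <= v1 t - v2 t - e * t) ->
  caputo a v2 t < caputo a v1 t.
Proof.
move=> a0; rewrite le_eqVlt => /predU1P[->|a1]; first exact: caputo_lt_max_eq1.
exact: caputo_lt_max_lt1.
Qed.

Lemma is_derive_ln_comp (f : R -> R) (x : R) : derivable f x 1 -> 0 < f x ->
  is_derive x 1 (fun y => ln (f y)) (derive1 f x / f x).
Proof.
move=> df f0; have h1 := is_derive1_ln f0.
have h2 : is_derive x 1 f (derive1 f x) by rewrite derive1E; exact: derivableP.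
have := @is_derive1_comp _ (@ln R) f x _ _ h1 h2; rewrite mulrC; exact.
Qed.

(* With z = ln u1 - ln u2 positive somewhere, z - e t attains its maximum over a
   box at some (x0, t0) with t0 > 0; there the Caputo derivative of z is positive,
   while the equation makes it equal to - c x0 dz/dx <= 0. The sign of x0 dz/dx at
   a maximum over a symmetric interval is right even on the boundary, so no decay
   at infinity is needed. *)
Lemma is_solution_le (a theta gamma : R) (u1 u2 : R -> R -> R) :
  0 < a -> a <= 1 -> 0 < gamma ->
  is_solution a theta gamma u1 -> is_solution a theta gamma u2 ->
  forall x t : R, 0 <= t -> u1 x t <= u2 x t.
Proof.
move=> a0 a1 gamma0 [p1 c1 d1 e1 i1] [p2 c2 d2 e2 i2] x1 t1 t10.
rewrite leNgt; apply/negP => u21.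
have t1_gt0 : 0 < t1.
  rewrite lt_neqAle t10 andbT eq_sym; apply/eqP => t1E.
  by move: u21; rewrite t1E i1 i2 ltxx.
pose z (p : R * R) := ln (u1 p.1 p.2) - ln (u2 p.1 p.2).
have z1 : 0 < z (x1, t1) by rewrite subr_gt0 ltr_ln// posrE; [exact: p2|exact: p1].
(* The summand 1 keeps the box nondegenerate when x1 = 0. *)
pose M := `|x1| + 1.
have M0 : 0 < M by rewrite ltr_pwDr.
(* With this slope [g] still equals half of [z] at (x1, t1), so its maximum is positive and cannot
   lie at time 0, where [z] vanishes. *)
pose e := z (x1, t1) / (2 * t1).
have e0 : 0 < e by rewrite divr_gt0// mulr_gt0.
pose g (p : R * R) := z p - e * p.2.
pose K : set (R * R) := `[- M, M] `*` `[0, t1].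
have cK : compact K by apply: compact_setX; exact: segment_compact.
have cln (u : R -> R -> R) : (forall xi t : R, 0 <= t -> 0 < u xi t) ->
    {within [set p : R * R | 0 <= p.2], continuous (fun p => u p.1 p.2)} ->
    forall p, K p -> (fun p => ln (u p.1 p.2)) @ within K (nbhs p) --> ln (u p.1 p.2).
  move=> u0 cu p Kp.
  have p20 : 0 <= p.2 by case: Kp => _ /=; rewrite in_itv/= => /andP[].
  apply: (@continuous_cvg _ _ _ _ _ _ (@ln R)).
    by apply: continuous_ln; exact: u0.
  have sK : K `<=` [set p : R * R | 0 <= p.2].
    by move=> q [_ /=]; rewrite in_itv/= => /andP[].
  exact: ((subspace_continuousP _ _).1 (continuous_subspaceW sK cu)).
have cg : {within K, continuous g}.
  apply/subspace_continuousP => p Kp; apply: cvgB; first by apply: cvgB; apply: cln.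
  apply: cvgM; first exact: cvg_cst.
  apply: (@cvg_trans _ (snd @ nbhs p)); last exact: cvg_snd.
  by apply: cvg_app; exact: cvg_within.
have K1 : K (x1, t1).
  split; rewrite /= in_itv/=; last by rewrite t10 lexx.
  by rewrite -ler_norml lerDl.
have [[x0 t0] + gmax] := compact_EVT_max (ex_intro _ _ K1) cK cg.
rewrite inE => -[/=]; rewrite !in_itv/= -ler_norml => x0M /andP[t00 t0t1].
have {}gmax x t : `|x| <= M -> 0 <= t <= t1 -> g (x, t) <= g (x0, t0).
  by move=> xM tt; apply: gmax; rewrite inE; split; rewrite /= in_itv/= -?ler_norml.
have g0 : 0 < g (x0, t0).
  apply: lt_le_trans (gmax x1 t1 _ _); rewrite ?lerDl ?t10 ?lexx//.
  rewrite /g /= /e (_ : _ / _ * t1 = z (x1, t1) / 2); last by field; rewrite gt_eqF.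
  by move: (z _) z1 => y; lra.
have t0_gt0 : 0 < t0.
  rewrite lt_neqAle t00 andbT eq_sym; apply/eqP => t0E.
  by move: g0; rewrite /g /z /= t0E i1 i2 subrr mulr0 subrr ltxx.
have cap : caputo a (fun s => ln (u2 x0 s)) t0 < caputo a (fun s => ln (u1 x0 s)) t0.
  apply: (caputo_lt_max a0 a1 e0 t0_gt0 (d1 x0) (d2 x0)) => r /andP[r0 rt].
  by apply: (gmax x0 r) => //; rewrite r0 (le_trans rt).
have [dx1 +] := e1 x0 t0 t00.
have [dx2 +] := e2 x0 t0 t00.
rewrite /Lop.
have dz := is_deriveB (is_derive_ln_comp dx1 (p1 x0 t0 t00)) (is_derive_ln_comp dx2 (p2 x0 t0 t00)).
have : 0 <= x0 * (derive1 (u1^~ t0) x0 / u1 x0 t0 - derive1 (u2^~ t0) x0 / u2 x0 t0).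
  apply: (is_derive_max_segment dz M0 x0M) => y yM.
  have := gmax y t0 yM; rewrite t00 t0t1 => /(_ isT).
  by rewrite /g /= lerD2r.
have := p1 x0 t0 t00; have := p2 x0 t0 t00.
have c0 : 0 < gamma / 2 `^ (1 - a) by rewrite divr_gt0// powR_gt0.
move: cap c0; clear.
move: (caputo _ _ _) (caputo _ _ _) (derive1 _ _) (derive1 _ _) (u1 _ _) (u2 _ _) (_ / 2 `^ _) (_ / 2 `^ _).
move=> C1 C2 D2 D1 U1 U2 th c C21 c0 U20 U10 xD E2 E1.
(* Dividing by the positive solution leaves the linear equation for its logarithm; the theta terms
   then cancel in C1 - C2. *)
have E1' : C1 = - c * (x0 * (D1 / U1)) - th * x0 ^+ 2.
  have U1n : U1 != 0 by rewrite gt_eqF.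
  by apply: (mulfI U1n); rewrite E1; field.
have E2' : C2 = - c * (x0 * (D2 / U2)) - th * x0 ^+ 2.
  have U2n : U2 != 0 by rewrite gt_eqF.
  by apply: (mulfI U2n); rewrite E2; field.
have := mulr_ge0 (ltW c0) xD; move: C21; rewrite E1' E2'.
move: (D1 / U1) (D2 / U2) => y1 y2; clear; nra.
Qed.

End comparison.

(** * Calculus of the relaxation function *)

Section integral_abs_continuous.
Context {R : realType}.
Let mu : {measure set (measurableTypeR R) -> \bar R} := lebesgue_measure.

(** Absolute continuity of the integral of |h|, applied to the union of the disjoint intervals. *)
Lemma integral_abs_continuous (a b : R) (h v : R -> R) :
  mu.-integrable setT (EFin \o h) ->
  (forall x y, a <= x -> x <= y -> y <= b ->
    v y - v x = \int[mu]_(s in `]x, y[) h s) ->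
  abs_continuous a b v.
Proof.
move=> ih vh e e0; have [d [d0 hd]] := integral_normr_continuous ih e0.
exists d => // n l r lr tI sd.
pose I i : set (measurableTypeR R) := `]l i, r i[%classic.
have mI i : measurable (I i) by exact: measurable_itv.
have mU : measurable (\big[setU/set0]_(i < n) I i) by exact: bigsetU_measurable.
have muI i : mu (I i) = (r i - l i)%:E.
  have -> : mu (I i) = lebesgue_measure (`]l i, r i[%classic : set R) by [].
  rewrite lebesgue_measure_itv/= lte_fin; have [_ [lri _]] := lr i.
  move: lri; rewrite le_eqVlt => /predU1P[->|->]; last by rewrite -EFinB.
  by rewrite ltxx subrr.
have muU : (mu (\big[setU/set0]_(i < n) I i) < d%:E)%E.
  rewrite measure_bigsetU_ord//; rewrite (eq_bigr (fun i => (r i - l i)%:E)); last by move=> i _; exact: muI.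
  by rewrite sumEFin lte_fin.
have {hd} := hd _ mU muU; apply: le_lt_trans.
have ihS (D : set (measurableTypeR R)) : measurable D -> mu.-integrable D (EFin \o h).
  by move=> mD; exact: integrableS ih.
have inS (D : set (measurableTypeR R)) : measurable D ->
    mu.-integrable D (EFin \o (fun x => `|h x|)).
  by move=> mD; exact: integrable_abse (ihS _ mD).
have -> : \int[mu]_(x in \big[setU/set0]_(i < n) I i) `|h x| =
    \sum_(i < n) \int[mu]_(x in I i) `|h x|.
  rewrite /Rintegral ge0_integral_bigsetU//; last 3 first.
  - by rewrite /index_enum -enumT enum_uniq.
  - exact: sub_trivIset tI.
  - by have /integrableP[] := inS _ mU.
  by rewrite sum_fine// => i _; exact: integrable_fin_num (inS _ (mI i)).
apply: ler_sum => i _; have [al [lri rb]] := lr i.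
by rewrite vh//; apply: le_normr_Rintegral => //; exact: ihS.
Qed.

End integral_abs_continuous.

Section relaxation.
Context {R : realType}.
Let mu : {measure set (measurableTypeR R) -> \bar R} := lebesgue_measure.
Variables (a l : R).
Hypotheses (a0 : 0 < a) (l0 : 0 < l).

Definition relaxation (t : R) : R := mittag_leffler a 1 (- l * t `^ a).

Lemma relaxation0 : relaxation 0 = 1.
Proof.
by rewrite /relaxation powR0 ?gt_eqF// mulr0 mittag_leffler0 Gamma_fun1 invr1.
Qed.

Lemma relaxation_ftc t : 0 < t ->
  mu.-integrable `]0, t[ (EFin \o relaxation_deriv a l) /\
  \int[mu]_(s in `]0, t[) relaxation_deriv a l s = relaxation t - 1.
Proof.
have E : (fun s => relaxation_deriv a l s * (t - s) `^ (1 - 1)) = relaxation_deriv a l.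
  by apply/funext => s; rewrite [X in _ `^ X]subrr powRr0 mulr1.
move=> t0; have [i1 e1] := relaxation_deriv_integral a0 l0 ltr01 t0.
rewrite E in i1 e1; split => //; rewrite e1 Gamma_fun1 mulr1 addrK.
by rewrite /relaxation mittag_leffler_shift// addrAC subrr add0r.
Qed.

Lemma continuous_relaxation_deriv t : 0 < t ->
  {for t, continuous (relaxation_deriv a l)}.
Proof.
move=> t0.
have cp p : {for t, continuous (fun s : R => s `^ p)}.
  apply/differentiable_continuous/derivable1_diffP; apply: derivable_powR.
  by rewrite in_itv/= t0.
apply: cvgM; first by apply: cvgM; [exact: cvg_cst|exact: cp].
apply: (@continuous_comp _ _ _ (fun s => - l * s `^ a) (mittag_leffler a a)).
  by apply: cvgM; [exact: cvg_cst|exact: cp].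
exact: continuous_mittag_leffler.
Qed.

(** Read off from the integral formula rather than from the series: near t the function is 1 plus
    the integral of [relaxation_deriv], which is continuous at t > 0. *)
Lemma is_derive_relaxation (t : R) : 0 < t ->
  is_derive t 1 relaxation (relaxation_deriv a l t).
Proof.
move=> t0; have t1 : t < t + 1 by rewrite ltrDl.
have i2 x : mu.-integrable `]0, x] (EFin \o relaxation_deriv a l).
  have [x0|x0] := leP 0 x; last first.
    by rewrite set_itv_ge ?integrable_set0// bnd_simp -leNgt ltW.
  have [i _] := relaxation_ftc (ltr_pwDr ltr01 x0).
  apply: integrableS i => //; apply: subset_itvl; rewrite bnd_simp.
  by rewrite ltrDl.
have [dF F'] := @continuous_FTC1 R _ (BRight 0) t (t + 1) t1 (i2 _) t0
  (continuous_relaxation_deriv t0).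
pose G x := \int[mu]_(s in `]0, x]) relaxation_deriv a l s.
have nE : \forall y \near t, (G + cst 1) y = relaxation y.
  have : t \in `]0, t + 1[ by rewrite in_itv/= t0.
  move/near_in_itvoo; apply: filterS => y; rewrite in_itv/= => /andP[y0 _].
  have [i e] := relaxation_ftc y0.
  rewrite -[LHS]/(G y + 1) /G.
  by rewrite -Rintegral_itv_bndo_bndc// e subrK.
have dG : derivable (G + cst 1) t 1 by apply: derivableD; [exact: dF|exact: derivable_cst].
split; first exact: near_eq_derivable nE dG.
rewrite -(near_eq_derive _ nE) (deriveD (dF : derivable G t 1) (derivable_cst _ _ _)).
by rewrite derive_cst addr0 -derive1E; exact: F'.
Qed.

Lemma continuous_relaxation : {within `[0, +oo[, continuous relaxation}.
Proof.
apply/continuous_within_itvcyP; split.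
  move=> t; rewrite in_itv/= andbT => t0.
  by apply/differentiable_continuous/derivable1_diffP; have [] := is_derive_relaxation t0.
rewrite /relaxation powR0 ?gt_eqF//.
apply: (cvg_comp (fun t => - l * t `^ a) (mittag_leffler a 1)); last exact: continuous_mittag_leffler.
by apply: cvgM; [exact: cvg_cst|exact: powR_cvg0].
Qed.

Lemma relaxation_increment (x y : R) : 0 <= x -> x <= y ->
  \int[mu]_(s in `]x, y[) relaxation_deriv a l s = relaxation y - relaxation x.
Proof.
move=> x0; rewrite le_eqVlt => /predU1P[->|xy].
  by rewrite set_itv_ge ?Rintegral_set0 ?subrr// bnd_simp ltxx.
have y0 := le_lt_trans x0 xy; have [iy ey] := relaxation_ftc y0.
move: x0; rewrite le_eqVlt => /predU1P[<-|x0]; first by rewrite ey relaxation0.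
have [ix ex] := relaxation_ftc x0.
have ax : (BRight 0 <= BRight x)%O by rewrite bnd_simp ltW.
have xb : (BRight x <= BLeft y)%O by rewrite bnd_simp.
rewrite -(Rintegral_itvB iy ax xb) -Rintegral_itv_bndo_bndc// ex ey.
by rewrite opprB addrA subrK.
Qed.

(** For a < 1 the derivative blows up like t^(a-1) at 0, so no Lipschitz bound is available; its
    integrability suffices. *)
Lemma abs_continuous_relaxation b : 0 < b -> abs_continuous 0 b relaxation.
Proof.
move=> b0; have [ib _] := relaxation_ftc b0.
have mb : measurable (`]0, b[%classic : set (measurableTypeR R)) by exact: measurable_itv.
apply: (@integral_abs_continuous _ _ _ (relaxation_deriv a l \_ `]0, b[%classic)).
  by rewrite -restrict_EFin; apply/(integrable_mkcond _ mb).1.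
move=> x y x0 xy yb; rewrite -relaxation_increment//.
apply: eq_Rintegral => s; rewrite mem_setE in_itv/= => /andP[xs sy].
by rewrite patchE mem_set//= in_itv/= (le_lt_trans x0 xs) (lt_le_trans sy yb).
Qed.

End relaxation.

Section open_interval_integrals.
Context {R : realType}.
Let mu : {measure set (measurableTypeR R) -> \bar R} := lebesgue_measure.

Lemma integrable_itv_closure (x y : R) (f : R -> R) :
  mu.-integrable `]x, y[ (EFin \o f) -> mu.-integrable `[x, y] (EFin \o f).
Proof.
move=> /integrableP[mf foo]; apply/integrableP; split.
  have [xy|yx] := ltP x y; last first.
    move: yx; rewrite le_eqVlt => /predU1P[->|yx].
      by rewrite set_itv1; exact: measurable_fun_set1.
    by rewrite set_itv_ge ?bnd_simp -?ltNge//; exact: measurable_fun_set0.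
  apply/emeasurable_fun_itv_bndo_bndcP; exact/emeasurable_fun_itv_obnd_cbndP.
rewrite (@integral_itv_bndoo _ x y _ true false)//.
by apply: measurableT_comp.
Qed.

Lemma Rintegral_itv_closure (x y : R) (f : R -> R) :
  mu.-integrable `]x, y[ (EFin \o f) ->
  \int[mu]_(s in `[x, y]) f s = \int[mu]_(s in `]x, y[) f s.
Proof.
by move=> /integrableP[mf _]; rewrite /Rintegral (@integral_itv_bndoo _ x y _ true false).
Qed.

End open_interval_integrals.

(** * Difference quotients on the time half-line *)

Section time_quotient.
Context {R : realType}.

#[local] Instance time_punctured_nbhs_filter (t : R) : Filter (time_punctured_nbhs t).
Proof. exact: within_filter. Qed.

Lemma near_time_punctured_nbhs (t : R) :
  \forall s \near time_punctured_nbhs t, 0 <= s /\ s != t.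
Proof.
have h : nbhs t (fun s : R => s != t -> `[0, +oo[%classic s -> 0 <= s /\ s != t).
  by apply: filterE => s st; rewrite /= in_itv/= andbT.
exact: h.
Qed.

Lemma time_punctured_nbhs_sub (t : R) : time_punctured_nbhs t --> t.
Proof.
by apply: cvg_trans; last apply: cvg_within; exact: cvg_within.
Qed.

Lemma at_right_time_punctured_nbhs (t : R) : 0 <= t ->
  t^'+ --> time_punctured_nbhs t.
Proof.
move=> t0 P hP.
have h1 : nbhs t (fun y => y != t -> `[0, +oo[%classic y -> P y) by exact: hP.
have h2 : nbhs t (fun y => t < y -> P y).
  apply: filterS h1 => y h ty; apply: h; first by rewrite gt_eqF.
  by rewrite /= in_itv/= andbT ltW// (le_lt_trans t0).
exact: h2.
Qed.

(** Uniqueness of limits calls for a proper filter; [t^'+] is one, and it refines the time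
    neighbourhoods. *)
Lemma lim_time_quotient (w : R -> R) (t L : R) : 0 <= t ->
  time_quotient w t s @[s --> time_punctured_nbhs t] --> L ->
  lim (time_quotient w t @ time_punctured_nbhs t) = L.
Proof.
move=> t0 wL; have cw : cvg (time_quotient w t @ time_punctured_nbhs t).
  by apply/cvg_ex; exists L.
apply: (@cvg_unique _ (@Rhausdorff R) (time_quotient w t @ t^'+)).
  by apply: cvg_trans cw; apply: cvg_app; exact: at_right_time_punctured_nbhs.
by apply: cvg_trans wL; apply: cvg_app; exact: at_right_time_punctured_nbhs.
Qed.

Lemma cvg_time_quotient (w : R -> R) (t D : R) : is_derive t 1 w D ->
  time_quotient w t s @[s --> time_punctured_nbhs t] --> D.
Proof.
move=> /is_derive1_caratheodory[g [wg cg <-]].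
apply: (@cvg_trans _ (g @ time_punctured_nbhs t)).
  apply: near_eq_cvg; near=> s.
  have [_ st] : 0 <= s /\ s != t by near: s; exact: near_time_punctured_nbhs.
  by rewrite /time_quotient wg mulfK// subr_eq0.
apply: cvg_trans cg; apply: cvg_app; exact: time_punctured_nbhs_sub.
Unshelve. all: by end_near. Qed.

End time_quotient.

(** * The explicit solution *)

Section relaxation_caputo.
Context {R : realType}.
Let mu : {measure set (measurableTypeR R) -> \bar R} := lebesgue_measure.
(** [Y] is kept apart from [relaxation]: the closed form contains the power a of 2 t, which splits
    as 2^a t^a only for t >= 0. The constant [A] will be theta xi^2 / (2 gamma), so that the
    function [v] below is ln u at fixed xi. *)
Variables (a l A : R) (Y : R -> R).
Hypotheses (a0 : 0 < a) (l0 : 0 < l).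
Hypothesis YE : forall t, 0 <= t -> Y t = relaxation a l t.

Let v (t : R) : R := A * (Y t - 1).

Let dY (t : R) : 0 < t -> is_derive t 1 v (A * relaxation_deriv a l t).
Proof.
move=> t0; have [dr er] := is_derive_relaxation a0 l0 t0.
have dB : is_derive t 1 (relaxation a l - cst 1) (relaxation_deriv a l t - 0).
  by have dr' := is_derive_relaxation a0 l0 t0; exact: is_deriveB.
pose w := A \*: (relaxation a l - cst 1 : R -> R^o).
have dw : is_derive t 1 w (A *: (relaxation_deriv a l t - 0)).
  exact: is_deriveZ.
rewrite subr0 in dw; have [dw1 dw2] := dw.
have nE : \forall y \near t, w y = v y.
  have : t \in `]0, t + 1[ by rewrite in_itv/= t0 ltrDl/=.
  move/near_in_itvoo; apply: filterS => y; rewrite in_itv/= => /andP[y0 _].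
  by rewrite /v YE ?ltW.
split; first exact: near_eq_derivable nE dw1.
by rewrite -(near_eq_derive _ nE) dw2.
Qed.

Lemma caputo_kernel_relaxation t s : s \in `]0, t[ ->
  caputo_kernel a v t s = A * (relaxation_deriv a l s * (t - s) `^ (1 - a - 1)).
Proof.
rewrite in_itv/= => /andP[s0 st]; rewrite /caputo_kernel derive1E.
have [_ ->] := dY s0; rewrite -powRN -mulrA; congr (_ * (_ * _ `^ _)).
by rewrite addrAC subrr add0r.
Qed.

Lemma caputo_integral_relaxation t : a < 1 -> 0 < t ->
  mu.-integrable `[0, t] (EFin \o caputo_kernel a v t) /\
  caputo_integral a v t = - A * l * relaxation a l t.
Proof.
move=> a1 t0; have q0 : 0 < 1 - a by rewrite subr_gt0.
have [i1 e1] := relaxation_deriv_integral a0 l0 q0 t0.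
have mS : measurable (`]0, t[%classic : set (measurableTypeR R)) by exact: measurable_itv.
have i2 : mu.-integrable `]0, t[ (EFin \o caputo_kernel a v t).
  apply: eq_integrable (integrableZl mS A i1) => // s; rewrite mem_setE => st.
  by rewrite /= caputo_kernel_relaxation.
split; first exact: integrable_itv_closure.
rewrite /caputo_integral (Rintegral_itv_closure i2).
rewrite (@eq_Rintegral _ _ _ mu _ (fun s => A * (relaxation_deriv a l s * (t - s) `^ (1 - a - 1)))); last first.
  by move=> s; rewrite mem_setE => st; rewrite caputo_kernel_relaxation.
rewrite (RintegralZl A mS i1) e1 /relaxation; clear e1.
(* With q = 1 - a the power of t becomes t^0 and the second Mittag-Leffler parameter becomes 1, so
   [relaxation] reappears. *)
rewrite (_ : a + (1 - a) = 1) ?subrr ?powRr0 ?mulr1; last by lra.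
have G0 : Gamma_fun (1 - a) != 0 by rewrite gt_eqF// Gamma_fun_gt0.
by rewrite !mulNr mulrN (mulrC l) !mulrN -!mulrA mulrCA mulKf// mulrA.
Qed.

Lemma cvg_caputo_integral_relaxation : a < 1 ->
  caputo_integral a v s @[s --> 0^'+] --> - A * l * relaxation a l 0.
Proof.
move=> a1; have [_ c0] := (continuous_within_itvcyP 0 (relaxation a l)).1 (continuous_relaxation a0 l0).
apply: (@cvg_trans _ ((fun s => - A * l * relaxation a l s) @ 0^'+)).
  apply: near_eq_cvg; near=> s; have s0 : 0 < s by near: s; exact: nbhs_right_gt.
  by have [_ ->] := caputo_integral_relaxation a1 s0.
by apply: cvgM; [exact: cvg_cst|exact: c0].
Unshelve. all: by end_near. Qed.

Lemma abs_continuous_relaxation_scale b : 0 < b -> abs_continuous 0 b v.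
Proof.
move=> b0 e e0.
have A0 : 0 < `|A| + 1 by rewrite ltr_pwDr.
have [d d0 hd] := abs_continuous_relaxation a0 l0 b0 (divr_gt0 e0 A0).
exists d => // n x y xy tI sd; have := hd n x y xy tI sd.
rewrite ltr_pdivlMr//; apply: le_lt_trans; rewrite mulr_suml.
apply: ler_sum => i _; have [x0 [xyi yb]] := xy i.
rewrite /v !YE//; last exact: le_trans xyi.
rewrite -mulrBr (_ : _ - 1 - _ = relaxation a l (y i) - relaxation a l (x i)); last by lra.
by rewrite normrM mulrC ler_wpM2l// lerDl.
Qed.

Lemma cvg_time_quotient_relaxation t : a = 1 -> 0 <= t ->
  time_quotient v t s @[s --> time_punctured_nbhs t] --> - A * l * relaxation a l t.
Proof.
move=> a1; rewrite le_eqVlt => /predU1P[<-|t0]; last first.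
  (* For a = 1 the factor t^(a-1) is 1 and E_{a,a} coincides with E_{a,1}. *)
  have -> : - A * l * relaxation a l t = A * relaxation_deriv a l t.
    rewrite /relaxation_deriv /relaxation a1 subrr powRr0 mulr1; ring.
  exact/cvg_time_quotient/dY.
(* By mittag_leffler_shift the difference quotient of v at 0 is exactly g. *)
pose g s := - A * l * mittag_leffler 1 2 (- l * s).
have g0 : g 0 = - A * l * relaxation a l 0.
  by rewrite /g mulr0 mittag_leffler0 Gamma_fun2 invr1 relaxation0.
have cg : {for 0, continuous g}.
  apply: cvgM; first exact: cvg_cst.
  apply: (@continuous_comp _ _ _ (fun s => - l * s) (mittag_leffler 1 2)).
    by apply: cvgM; [exact: cvg_cst|exact: cvg_id].
  exact: continuous_mittag_leffler.
rewrite -g0; apply: (@cvg_trans _ (g @ time_punctured_nbhs 0)).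
  apply: near_eq_cvg; near=> s.
  have [s0 sn0] : 0 <= s /\ s != 0 by near: s; exact: near_time_punctured_nbhs.
  clear cg g0.
  rewrite /time_quotient /v (YE s0) (YE (lexx 0)) relaxation0// subrr mulr0 !subr0.
  rewrite /relaxation a1 powRr1//.
  by rewrite mittag_leffler_shift// /g; field.
apply: cvg_trans cg; apply: cvg_app; exact: time_punctured_nbhs_sub.
Unshelve. all: by end_near. Qed.

Lemma caputo_relaxation t : a <= 1 -> 0 <= t ->
  caputo a v t = - A * l * relaxation a l t.
Proof.
rewrite le_eqVlt => /predU1P[a1|a1] t0; rewrite /caputo.
  have -> : (a == 1) = true by rewrite a1 eqxx.
  exact: (lim_time_quotient t0 (cvg_time_quotient_relaxation a1 t0)).
rewrite lt_eqF//; have [->|tn0] := eqVneq t 0.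
  by apply/cvg_lim => //; exact: cvg_caputo_integral_relaxation.
have t_gt0 : 0 < t by rewrite lt_def tn0.
by have [_ ->] := caputo_integral_relaxation a1 t_gt0.
Qed.

Lemma caputo_derivable_relaxation : a <= 1 -> caputo_derivable a v.
Proof.
rewrite le_eqVlt => /predU1P[a1|a1]; rewrite /caputo_derivable.
  rewrite a1 eqxx => t t0; apply/cvg_ex; eexists.
  exact: cvg_time_quotient_relaxation.
rewrite lt_eqF//; split.
- by move=> b b0; exact: abs_continuous_relaxation_scale.
- by move=> t t0; have [] := caputo_integral_relaxation a1 t0.
- by apply/cvg_ex; eexists; exact: cvg_caputo_integral_relaxation.
Qed.

End relaxation_caputo.

Section explicit_solution.
Context {R : realType} (a theta gamma : R).
Hypotheses (a0 : 0 < a) (a1 : a <= 1) (gamma0 : 0 < gamma).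
Let l := gamma * 2 `^ a.
Let Y (t : R) := mittag_leffler a 1 (- gamma * (2 * t) `^ a).

Let l0 : 0 < l.
Proof. by rewrite mulr_gt0// powR_gt0. Qed.

Let YE (t : R) : 0 <= t -> Y t = relaxation a l t.
Proof. by move=> t0; rewrite /Y powRM// /relaxation /l mulrA mulNr. Qed.

Let u (xi t : R) := expR (- (theta * xi ^+ 2 / (2 * gamma)) * (1 - Y t)).

Let lnu xi : (fun t => ln (u xi t)) = (fun t => theta * xi ^+ 2 / (2 * gamma) * (Y t - 1)).
Proof. by apply/funext => t; rewrite expRK mulNr -mulrN opprB. Qed.

Let continuous_u : {within [set p : R * R | 0 <= p.2], continuous (fun p => u p.1 p.2)}.
Proof.
apply/subspace_continuousP => p p20.
apply: (@continuous_cvg _ _ _ _ _ _ (@expR R)); first exact: continuous_expR.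
have F := within_filter [set p : R * R | 0 <= p.2] (nbhs_filter p).
apply: cvgM.
  apply: cvgN; apply: cvgM; last exact: cvg_cst.
  apply: cvgM; first exact: cvg_cst.
  have h : q.1 @[q --> within [set p : R * R | 0 <= p.2] (nbhs p)] --> p.1.
    apply: (@cvg_trans _ (fst @ nbhs p)); last exact: cvg_fst.
    by apply: cvg_app; exact: cvg_within.
  exact: (cvgM h h).
apply: cvgB; first exact: cvg_cst.
rewrite (YE p20).
apply: (@cvg_trans _ (relaxation a l q.2 @[q --> within [set p : R * R | 0 <= p.2] (nbhs p)])).
  apply: near_eq_cvg.
  have h : nbhs p (fun q => 0 <= q.2 -> relaxation a l q.2 = Y q.2).
    by apply: filterE => q q0; rewrite YE.
  exact: h.
have p2m : `[0, +oo[%classic p.2 by rewrite /= in_itv/= andbT.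
(* At time 0 continuity is only one-sided; the second projection maps the half-plane into the
   half-line, so the one-variable limit suffices. *)
apply: (@cvg_trans _ (relaxation a l y @[y --> within `[0, +oo[%classic (nbhs p.2)])).
  2: exact: (subspace_continuousP _ _).1 (continuous_relaxation a0 l0) _ p2m.
move=> P hP.
have h : nbhs p.2 (fun y => `[0, +oo[%classic y -> P (relaxation a l y)) by exact: hP.
have h2 : nbhs p (fun q => 0 <= q.2 -> P (relaxation a l q.2)).
  have h3 : nbhs p (fun q : R * R => `[0, +oo[%classic q.2 -> P (relaxation a l q.2)).
    exact: (@cvg_snd _ _ _ _ (nbhs_filter p.1) _ h).
  by apply: filterS h3 => q hq q0; apply: hq; rewrite /= in_itv/= andbT.
exact: h2.
Qed.

Let is_derive_u (xi t : R) :
  is_derive xi 1 (fun x => u x t) (- (theta / gamma * xi * (1 - Y t)) * u xi t).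
Proof.
rewrite /u; move: (Y t) => y.
pose k := - (theta / (2 * gamma)) * (1 - y).
have kE x : - (theta * x ^+ 2 / (2 * gamma)) * (1 - y) = k * x ^+ 2.
  by rewrite /k; field; rewrite gt_eqF.
have -> : (fun x => expR (- (theta * x ^+ 2 / (2 * gamma)) * (1 - y))) =
    (fun x => expR (k * x ^+ 2)) by apply/funext => x; rewrite kE.
rewrite kE.
have h : is_derive xi 1 (fun x : R => k * x ^+ 2) (k * (2 * xi)).
  apply: (is_derive_eq (is_deriveZ k (is_deriveX 2 (is_derive_id xi (1 : R))))).
  by rewrite /GRing.scale /= expr1; ring.
apply: (is_derive_eq (@is_derive1_comp _ (@expR R) (fun x : R => k * x ^+ 2) xi _ _
  (is_derive_expR _) h)).
by rewrite mulrC; congr (_ * _); rewrite /k; field; rewrite gt_eqF.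
Qed.

(** [P] stands for 2^a, so 2 / P is 2^(1-a), and [y] stands for [Y t]. Both sides reduce to - (theta
    P / 2) xi^2 y U. *)
Let pde_balance (P U y xi : R) : P != 0 -> gamma != 0 ->
  U * (- (theta * xi ^+ 2 / (2 * gamma)) * (gamma * P) * y) =
  - (gamma / (2 / P)) * xi * (- (theta / gamma * xi * (1 - y)) * U) -
  theta / (2 / P) * xi ^+ 2 * U.
Proof. by move=> P0 g0; field; rewrite P0 g0. Qed.

(* ln (u xi t) = (theta xi^2 / (2 gamma)) (Y t - 1), and the relaxation function Y
   satisfies D^a Y = - l Y, which turns the equation into pde_balance. *)
Lemma is_solution_mittag_leffler : is_solution a theta gamma u.
Proof.
split.
- by move=> xi t _; exact: expR_gt0.
- exact: continuous_u.
- by move=> xi; rewrite lnu; exact: (caputo_derivable_relaxation (theta * xi ^+ 2 / (2 * gamma)) a0 l0 YE a1).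
- move=> xi t t0; have [dx dE] := is_derive_u xi t.
  split; first exact: dx.
  rewrite derive1E dE /Lop lnu (caputo_relaxation (theta * xi ^+ 2 / (2 * gamma)) a0 l0 YE a1 t0) -(YE t0).
  have -> : 2 `^ (1 - a) = 2 / 2 `^ a :> R.
    by rewrite powRD ?powRr1 ?powRN// pnatr_eq0 implybT.
  apply: pde_balance; rewrite gt_eqF//; exact: powR_gt0.
- by move=> xi; rewrite /u (YE (lexx 0)) (relaxation0 _ a0) subrr mulr0 expR0.
Qed.

End explicit_solution.

Theorem theorem6 (R : realType) (alpha theta gamma : R)
    (alpha_gt0 : 0 < alpha) (alpha_le1 : alpha <= 1)
    (theta_gt0 : 0 < theta) (gamma_gt0 : 0 < gamma) :
  is_solution alpha theta gamma
    (fun xi t => expR (- (theta * xi ^+ 2 / (2 * gamma)) *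
      (1 - mittag_leffler alpha 1 (- gamma * (2 * t) `^ alpha)))) /\
  (forall u : R -> R -> R, is_solution alpha theta gamma u ->
    forall xi t : R, 0 <= t ->
      u xi t = expR (- (theta * xi ^+ 2 / (2 * gamma)) *
        (1 - mittag_leffler alpha 1 (- gamma * (2 * t) `^ alpha)))).
Proof.
have hsol := is_solution_mittag_leffler theta alpha_gt0 alpha_le1 gamma_gt0.
split; first exact: hsol.
move=> u hu xi t t0; apply/le_anti/andP; split.
- exact: (is_solution_le alpha_gt0 alpha_le1 gamma_gt0 hu hsol).
- exact: (is_solution_le alpha_gt0 alpha_le1 gamma_gt0 hsol hu).
Qed.
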